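(* Let $w\in(1,\infty]$ and $Q_0\subsetneqq\mathbb{R}^n$ be a cube. Then $$\bigcup_{v\in(1,\infty)}hk_{(v,w,0)_{0}}(Q_0)\subset h^{1,w}_{at}(Q_0).$$ Moreover, if $g\in\bigcup_{v\in(1,\infty)}hk_{(v,w,0)_0}(Q_0)$, then $$\|g\|_{h^{1,w}_{at}(Q_0)}\le\liminf_{v\to1^+}\|g\|_{hk_{(v,w,0)_0}(Q_0)},$$ where $v\to1^+$ means that $v\in(1,\infty)$ and $v\to1$. Here an element $g\in hk_{(v,w,0)_0}(Q_0)$ is identified with the function $h\in L^1(Q_0)$ satisfying $\langle g,f\rangle=\int_{Q_0}hf$ for all $f\in L^\infty(Q_0)$.
   Context: $\mathbb{Z}_+=\{0,1,2,\dots\}$. A cube $Q\subset\mathbb{R}^n$ has edges parallel to the coordinate axes and finite positive side length $\ell(Q)$, and is not necessarily closed. Functions are complex-valued, measurable and identified when equal almost everywhere. $f_Q:=\fint_Q f:=\frac1{|Q|}\int_Q f$. Fix $c_0\in(0,\ell(Q_0))$ (the same constant in all definitions below). Let $P^{(0)}_{Q,c_0}(f):=f_Q$ if $\ell(Q)<c_0$ and $P^{(0)}_{Q,c_0}(f):=0$ if $\ell(Q)\ge c_0$. For $r\in[1,\infty]$, $1/r+1/r'=1$. For $p\in(1,\infty)$, $q\in[1,\infty)$, $jn_{(p,q,0)_0}(Q_0)$ is the set of all $f\in L^q(Q_0)$ with $$\|f\|_{jn_{(p,q,0)_0}(Q_0)}:=\sup\Big[\sum_{j}|Q_j|\Big\{\Big[\fint_{Q_j}|f-P^{(0)}_{Q_j,c_0}(f)|^q\Big]^{1/q}\Big\}^p\Big]^{1/p}<\infty,$$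 the supremum being over all countable (finite or infinite) collections $\{Q_j\}_j$ of cubes in $Q_0$ with pairwise disjoint interiors. (Note $L^\infty(Q_0)\subset jn_{(p,q,0)_0}(Q_0)$.) Local atoms: for $v\in[1,\infty)$, $w\in(1,\infty]$, a function $a$ on $\mathbb{R}^n$ is a local $(v,w,0)_0$-atom supported in a cube $Q$ if $\{a\ne0\}\subset Q$; $\|a\|_{L^w(Q)}\le|Q|^{\frac1w-\frac1v}$; and, when $\ell(Q)<c_0$, $\int_Q a=0$. For $v\in(1,\infty)$, an atom supported in a cube of $Q_0$ acts on $f\in jn_{(v',w',0)_0}(Q_0)$ by $f\mapsto\int_Q af$. The dual $(jn_{(v',w',0)_0}(Q_0))^*$ is equipped with the weak-$*$ topology. $\widetilde{hk}_{(v,w,0)_0}(Q_0)$, $v\in(1,\infty)$, is the set of all $g\in(jn_{(v',w',0)_0}(Q_0))^*$ of the form $g=\sum_j\lambda_ja_j$ (weak-$*$ convergence), where the $a_j$ are local $(v,w,0)_0$-atoms supported respectively in cubes $Q_j\subset Q_0$ with pairwise disjoint interiors (countably many), $\lambda_j\in\mathbb{C}$ and $\sum_j|\lambda_j|^v<\infty$; $\|g\|_{\widetilde{hk}_{(v,w,0)_0}(Q_0)}:=\inf(\sum_j|\lambda_j|^v)^{1/v}$ over all such decompositions. $hk_{(v,w,0)_0}(Q_0)$ is the set of all $g\in(jn_{(v',w',0)_0}(Q_0))^*$ such that $g=\sum_{i\in\mathbb{N}}g_i$ weak-$*$ with $g_i\in\widetilde{hk}_{(v,w,0)_0}(Q_0)$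 and $\sum_i\|g_i\|_{\widetilde{hk}_{(v,w,0)_0}(Q_0)}<\infty$; its norm is $\inf\sum_i\|g_i\|_{\widetilde{hk}_{(v,w,0)_0}(Q_0)}$ over all such decompositions. (For $1<v_1<v_2<\infty$ one has $hk_{(v_2,w,0)_0}(Q_0)\subset hk_{(v_1,w,0)_0}(Q_0)$.) Atomic localized Hardy space: $h^{1,w}_{at}(Q_0)$ is the set of all $f\in L^1(Q_0)$ such that $f=\sum_{j\in\mathbb{N}}\lambda_ja_j$ in $L^1(Q_0)$, where the $a_j$ are local $(1,w,0)_0$-atoms supported respectively in cubes $Q_j\subset Q_0$ and $\lambda_j\in\mathbb{C}$ with $\sum_j|\lambda_j|<\infty$; $\|f\|_{h^{1,w}_{at}(Q_0)}:=\inf\sum_j|\lambda_j|$ over all such decompositions. *)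

(* Defs.v *)
From HB Require Import structures.
From mathcomp Require Import all_boot all_order all_algebra.
From mathcomp Require Import all_classical all_reals all_analysis.
From mathcomp Require Import complex.

Set Implicit Arguments.
Unset Strict Implicit.
Unset Printing Implicit Defensive.

Import Order.TTheory GRing.Theory Num.Theory.
Import numFieldNormedType.Exports.

Local Open Scope classical_set_scope.
Local Open Scope ring_scope.

(* R^n as a measurable space; its product sigma-algebra is the Borel one.  As
   functions are identified when equal a.e., Borel functions represent all
   Lebesgue measurable ones. *)
Notation Rn R n := (n.-tuple (measurableTypeR R)).

Section lebesgue_measure_n.
Context (R : realType).
Local Open Scope ereal_scope.

Definition cons_Rn n (z : measurableTypeR R * Rn R n) : Rn R n.+1 :=
  [tuple of z.1 :: z.2].

Lemma measurable_cons_Rn n : measurable_fun setT (@cons_Rn n).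
Proof. exact: measurable_cons. Qed.

HB.instance Definition _ n :=
  isMeasurableFun.Build _ _ _ _ (@cons_Rn n) (@measurable_cons_Rn n).

Section step.
Context (n : nat) (m1 : {sigma_finite_measure set (measurableTypeR R) -> \bar R})
  (m : {sigma_finite_measure set (Rn R n) -> \bar R}).

Definition cons_measure : set (Rn R n.+1) -> \bar R :=
  pushforward (m1 \x m) (@cons_Rn n).

Let cons_measure0 : cons_measure set0 = 0.
Proof. exact: measure0. Qed.

Let cons_measure_ge0 A : 0 <= cons_measure A.
Proof. exact: measure_ge0. Qed.

Let cons_measure_sigma_additive : semi_sigma_additive cons_measure.
Proof. exact: measure_semi_sigma_additive. Qed.

HB.instance Definition _ := isMeasure.Build _ _ _ cons_measure
  cons_measure0 cons_measure_ge0 cons_measure_sigma_additive.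

Let cons_measure_sigma_finite : sigma_finite setT cons_measure.
Proof.
have /sigma_finiteP[F [TF ndF Foo]] := sigma_finiteT m1.
have /sigma_finiteP[G [TG ndG Goo]] := sigma_finiteT m.
pose split (t : Rn R n.+1) : measurableTypeR R * Rn R n :=
  (thead t, [tuple of behead t]).
have splitK : cancel (@cons_Rn n) split.
  by case=> x t; congr pair; rewrite /= ?theadE//; exact: val_inj.
have msplit : measurable_fun setT split.
  apply: measurable_fun_pair; last exact: measurable_behead.
  exact: (measurable_tnth ord0).
exists (fun k => split @^-1` (F k `*` G k)).
  rewrite -preimage_bigcup [X in _ @^-1` X](_ : _ = setT) ?preimage_setT//.
  apply/seteqP; split=> // -[x t] _.
  have [i _ Fix] : (\bigcup_i F i) x by rewrite -TF.
  have [j _ Gjt] : (\bigcup_j G j) t by rewrite -TG.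
  exists (maxn i j) => //; split => /=.
  - by move: x Fix; exact/subsetPset/ndF/leq_maxl.
  - by move: t Gjt; exact/subsetPset/ndG/leq_maxr.
move=> k; have [mF Fk] := Foo k; have [mG Gk] := Goo k; split.
  by rewrite -[X in measurable X]setTI; apply: msplit => //; exact: measurableX.
have -> : cons_measure (split @^-1` (F k `*` G k)) = (m1 \x m) (F k `*` G k).
  rewrite /cons_measure /pushforward; congr (product_measure1 _ _ _).
  by apply/funext => z; exact: (congr1 (F k `*` G k) (splitK z)).
by rewrite product_measure1E// lte_mul_pinfty// ge0_fin_numE.
Qed.

HB.instance Definition _ := Measure_isSigmaFinite.Build _ _ _ cons_measure
  cons_measure_sigma_finite.

End step.

(* Lebesgue measure on R^n, as the n-fold product of the one-dimensional one. *)
Fixpoint lebesgue_measure_n n : {sigma_finite_measure set (Rn R n) -> \bar R} :=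
  match n with
  | 0 => \d_([tuple] : Rn R 0)
  | k.+1 => cons_measure (@lebesgue_measure R) (lebesgue_measure_n k)
  end.

Lemma lebesgue_measure_n_box n (I : 'I_n -> set (measurableTypeR R)) :
  (forall i, measurable (I i)) ->
  measurable [set x : Rn R n | forall i, I i (tnth x i)] /\
  lebesgue_measure_n n [set x | forall i, I i (tnth x i)] =
    \prod_(i < n) @lebesgue_measure R (I i).
Proof.
elim: n I => [|n IH] I mI.
  rewrite big_ord0 [X in measurable X](_ : _ = setT); last first.
    by apply/seteqP; split=> // x _ [].
  rewrite [X in _ X = _](_ : _ = setT); last first.
    by apply/seteqP; split=> // x _ [].
  split; first exact: measurableT.
  by rewrite /= diracT.
have [mB EB] := IH (fun i => I (lift ord0 i)) (fun i => mI _).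
have mB' : measurable [set x : Rn R n.+1 | forall i, I i (tnth x i)].
  rewrite (_ : [set x | _] =
    \bigcap_(i in [set: 'I_n.+1]) [set x : Rn R n.+1 | I i (tnth x i)]); last first.
    by apply/seteqP; split => x /= h i; [move=> _|]; exact: h.
  apply: fin_bigcap_measurable => // i _.
  rewrite -[X in measurable X]setTI; exact: (measurable_tnth i).
split=> //.
rewrite big_ord_recl -EB /= /cons_measure /pushforward -product_measure1E//.
congr (product_measure1 _ _ _); apply/seteqP; split => -[x t] /=.
  move=> h; split; first exact: (h ord0).
  by move=> i; have := h (lift ord0 i); rewrite tnthS; congr (I _ _); congr tnth; exact: val_inj.
case=> hx ht i; case: (unliftP ord0 i) => [j ->|->//].
by have := ht j; rewrite tnthS; congr (I _ _); congr tnth; exact: val_inj.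
Qed.

End lebesgue_measure_n.

Section cubes.
Context (R : realType) (n : nat).

(* A cube is a product of n bounded intervals of the same length; each of its
   2n faces may or may not belong to it. *)
Record cube := Cube {
  corner : 'I_n -> R;
  side : R;
  left_closed : 'I_n -> bool;
  right_closed : 'I_n -> bool;
  side_gt0 : 0 < side }.

Definition cube_set (Q : cube) : set (Rn R n) :=
  [set x | forall i, (tnth x i : R) \in
     Interval (BSide (left_closed Q i) (corner Q i))
              (BSide (~~ right_closed Q i) (corner Q i + side Q))].

(* Topological interior in R^n (tuples carry no topology in the library). *)
Definition interior_Rn (A : set (Rn R n)) : set (Rn R n) :=
  [set x | exists2 e : R, 0 < e &
     forall y : Rn R n,
       (forall i, `|(tnth y i : R) - (tnth x i : R)| < e) -> A y].

(* A countable, finite or infinite, family (Q j), j in J, of cubes in Q0 with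
   pairwise disjoint interiors. *)
Definition disjoint_cubes (Q0 : cube) (J : set nat) (Q : nat -> cube) : Prop :=
  (forall j, J j -> cube_set (Q j) `<=` cube_set Q0) /\
  trivIset J (fun j => interior_Rn (cube_set (Q j))).

Definition volume (Q : cube) : R := fine (lebesgue_measure_n R n (cube_set Q)).

End cubes.

Notation cabs := (@ComplexField.Normc.normc _).

Section complex_functions.
Context (R : realType) (n : nat).
Local Notation mu := (lebesgue_measure_n R n).
Implicit Types (D : set (Rn R n)) (f : Rn R n -> R[i]) (Q : cube R n).

Definition cmeasurable D f : Prop :=
  measurable_fun D (fun x => complex.Re (f x)) /\
  measurable_fun D (fun x => complex.Im (f x)).

Definition cintegral D f : R[i] :=
  Complex (\int[mu]_(x in D) complex.Re (f x))
          (\int[mu]_(x in D) complex.Im (f x)).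

Definition Lp_norm D (p : \bar R) f : \bar R :=
  ('N[mu]_p[EFin \o ((fun x => cabs (f x)) \_ D)])%E.

(* Functions are total; only their values on D matter, up to null sets. *)
Definition Lp D (p : \bar R) f : Prop :=
  cmeasurable D f /\ (Lp_norm D p f < +oo)%E.

Definition average Q f : R[i] :=
  real_complex R (volume Q)^-1 * cintegral (cube_set Q) f.

(* Convergence stated through the modulus: R[i] has no topology here. *)
Definition ccvg (z : nat -> R[i]) (l : R[i]) : Prop :=
  (fun N => cabs (z N - l)) @ \oo --> (0 : R).

(* The conjugate exponent of p in (1, +oo], as a real number. *)
Definition conj_exponent (p : \bar R) : R := fine (hoelder_conjugate p).

End complex_functions.

Section spaces.
Context (R : realType) (n : nat) (c0 : R) (Q0 : cube R n).
Local Notation mu := (lebesgue_measure_n R n).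
Local Notation func := (Rn R n -> R[i]).

Definition P0 (Q : cube R n) (f : func) : R[i] :=
  if side Q < c0 then average Q f else 0.

Definition mean_osc (q : R) (Q : cube R n) (f : func) : \bar R :=
  (((volume Q)^-1%:E *
    \int[mu]_(x in cube_set Q) ((cabs (f x - P0 Q f)) `^ q)%:E) `^ q^-1)%E.

Definition jn_norm (p q : R) (f : func) : \bar R :=
  ereal_sup [set s | exists J (Q : nat -> cube R n),
    disjoint_cubes Q0 J Q /\
    s = ((\esum_(j in J) ((volume (Q j))%:E * mean_osc q (Q j) f `^ p))
           `^ p^-1)%E].

Definition jn (p q : R) (f : func) : Prop :=
  Lp (cube_set Q0) q%:E f /\ (jn_norm p q f < +oo)%E.

(* Elements of the dual of jn are represented by functionals defined on all
   functions; only their values on jn matter.  As jn_norm vanishes on functions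
   that are null a.e. on Q0, these functionals respect a.e. equality. *)
Definition functional := func -> R[i].

Definition jn_dual (p q : R) (g : functional) : Prop :=
  [/\ forall f1 f2, jn p q f1 -> jn p q f2 ->
        g (fun x => f1 x + f2 x) = g f1 + g f2,
      forall (k : R[i]) f, jn p q f -> g (fun x => k * f x) = k * g f
    & exists M : R, forall f, jn p q f ->
        ((cabs (g f))%:E <= M%:E * jn_norm p q f)%E].

Definition weak_star_cvg (p q : R) (S : nat -> functional) (g : functional) :=
  forall f, jn p q f -> ccvg (fun N => S N f) (g f).

Definition local_atom (v : R) (w : \bar R) (Q : cube R n) (a : func) : Prop :=
  [/\ cmeasurable setT a,
      [set x | a x != 0] `<=` cube_set Q,
      (Lp_norm (cube_set Q) w a <=
        ((volume Q) `^ (fine (w^-1)%E - v^-1))%:E)%E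
    & side Q < c0 -> cintegral (cube_set Q) a = 0].

Definition atom_action (Q : cube R n) (a : func) : functional :=
  fun f => cintegral (cube_set Q) (fun x => a x * f x).

Definition hkt_decomposition (v : R) (w : \bar R) (g : functional)
    (J : set nat) (Q : nat -> cube R n) (a : nat -> func)
    (lam : nat -> R[i]) : Prop :=
  [/\ disjoint_cubes Q0 J Q,
      forall j, J j -> local_atom v w (Q j) (a j),
      (\esum_(j in J) ((cabs (lam j)) `^ v)%:E < +oo)%E
    & weak_star_cvg (conj_exponent v%:E) (conj_exponent w)
        (fun N f => \sum_(j < N | (j : nat) \in J)
                      lam j * atom_action (Q j) (a j) f) g].

Definition hkt (v : R) (w : \bar R) (g : functional) : Prop :=
  jn_dual (conj_exponent v%:E) (conj_exponent w) g /\
  exists J Q a lam, hkt_decomposition v w g J Q a lam.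

Definition hkt_norm (v : R) (w : \bar R) (g : functional) : \bar R :=
  ereal_inf [set s | exists J Q a lam, hkt_decomposition v w g J Q a lam /\
    s = ((\esum_(j in J) ((cabs (lam j)) `^ v)%:E) `^ v^-1)%E].

Definition hk_decomposition (v : R) (w : \bar R) (g : functional)
    (gs : nat -> functional) : Prop :=
  [/\ forall i, hkt v w (gs i),
      (\sum_(0 <= i <oo) hkt_norm v w (gs i) < +oo)%E
    & weak_star_cvg (conj_exponent v%:E) (conj_exponent w)
        (fun N f => \sum_(i < N) gs i f) g].

Definition hk (v : R) (w : \bar R) (g : functional) : Prop :=
  jn_dual (conj_exponent v%:E) (conj_exponent w) g /\
  exists gs, hk_decomposition v w g gs.

(* As jn (v', w') shrinks when v decreases, the inclusion of hk (v2, w) in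
   hk (v1, w), v1 < v2, is restriction of functionals and fixes the underlying
   [functional]; so the same g is measured in hk (v, w) for all small v. *)
Definition hk_norm (v : R) (w : \bar R) (g : functional) : \bar R :=
  ereal_inf [set s | exists gs, hk_decomposition v w g gs /\
    s = (\sum_(0 <= i <oo) hkt_norm v w (gs i))%E].

Definition h1at_decomposition (w : \bar R) (f : func) (Q : nat -> cube R n)
    (a : nat -> func) (lam : nat -> R[i]) : Prop :=
  [/\ forall j, cube_set (Q j) `<=` cube_set Q0,
      forall j, local_atom 1 w (Q j) (a j),
      (\sum_(0 <= j <oo) (cabs (lam j))%:E < +oo)%E
    & (fun N => Lp_norm (cube_set Q0) 1%:E
         (fun x => f x - \sum_(j < N) lam j * a j x)) @ \oo --> 0%E].

Definition h1at (w : \bar R) (f : func) : Prop :=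
  Lp (cube_set Q0) 1%:E f /\
  exists Q a lam, h1at_decomposition w f Q a lam.

Definition h1at_norm (w : \bar R) (f : func) : \bar R :=
  ereal_inf [set s | exists Q a lam, h1at_decomposition w f Q a lam /\
    s = (\sum_(0 <= j <oo) (cabs (lam j))%:E)%E].

(* The functional g is identified with the integrable function h, which is
   unique up to a.e. equality on Q0. *)
Definition represents (g : functional) (h : func) : Prop :=
  Lp (cube_set Q0) 1%:E h /\
  forall f, Lp (cube_set Q0) +oo%E f ->
    g f = cintegral (cube_set Q0) (fun x => h x * f x).

End spaces.

(* Main.v *)
(* If [a] is a local (v, w, 0)_0-atom supported in [Q], then [|Q|^(1/v - 1) a]
   is a local (1, w, 0)_0-atom, so [lam a] has [h^1_at]-size at most
   [|lam| |Q|^(1 - 1/v)].  For cubes with pairwise disjoint interiors in [Q0],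
   Hoelder's inequality gives
   [sum_j |lam_j| |Q_j|^(1 - 1/v) <= |Q0|^(1 - 1/v) (sum_j |lam_j|^v)^(1/v)].
   Hence every [g] in [hk_(v,w)] has an atomic decomposition into (1, w)-atoms
   converging absolutely in [L^1(Q0)]; its sum represents [g] because
   [L^oo(Q0)] is contained in [jn], and the representing function is unique.
   This yields [|g|_(h^1_at) <= |Q0|^(1 - 1/v) |g|_(hk_(v,w))] for every [v > 1],
   and the factor tends to 1 as [v] tends to 1. *)
Require Import Defs.
From mathcomp Require Import all_boot all_order all_algebra.
From mathcomp Require Import all_classical all_reals all_analysis.
From mathcomp Require Import complex.
From mathcomp Require Import measurable_realfun ess_sup_inf lra.

Set Implicit Arguments.
Unset Strict Implicit.
Unset Printing Implicit Defensive.

Import Order.TTheory GRing.Theory Num.Theory.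
Import numFieldNormedType.Exports.

Local Open Scope classical_set_scope.
Local Open Scope ring_scope.

(** * Real series and convergence in L^1 *)

(** Both sums in the definition of [hk] converge only weak-*, so neither the rearrangement into one
    atomic series nor the passage to a function is automatic. The remedy is to test against bounded
    [f] alone: a (1, w)-atom has L^1 norm at most 1, hence acts on [f] with modulus at most a
    constant times the essential bound of [f], and the array of terms indexed by pairs (i, j) is
    absolutely summable. Fubini for series then gives the flattened series the same sum as the
    iterated one. The function so obtained depends on the decomposition and on the error allowed in
    choosing it; uniqueness almost everywhere transfers each decomposition to one fixed [h], so that
    the infimum defining [hk_norm] can be taken. Complex integrals and limits are treated through
    real and imaginary parts, which is the origin of the constants 2 and 3 in the estimates. *)

Section real_series.
Context (R : realType).
Implicit Types (u b x : nat -> R).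

Lemma nneseries_term_le (f : nat -> \bar R) i : (forall k, (0 <= f k)%E) ->
  (f i <= \sum_(0 <= k <oo) f k)%E.
Proof.
move=> f0; rewrite (nneseries_split_cond 0 i.+1)// big_nat_recr//=.
by rewrite -addeA addeCA leeDl// adde_ge0 ?sume_ge0 ?nneseries_ge0.
Qed.

Lemma ge0_series_cvg u S : (forall k, 0 <= u k) ->
  (\sum_(0 <= k <oo) (u k)%:E = S%:E)%E ->
  (fun N => \sum_(k < N) u k) @ \oo --> S.
Proof.
move=> u0 uS.
have : (fun N => \sum_(0 <= k < N) (u k)%:E)%E @ \oo --> S%:E.
  by rewrite -uS; apply: is_cvg_nneseries => k _ _; rewrite lee_fin.
rewrite (_ : (fun N => _) = (fun N => (\sum_(k < N) u k)%:E)); last first.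
  by apply/funext => N; rewrite big_mkord sumEFin.
by move=> /fine_cvgP[].
Qed.

(** Tonelli for series: the iterated and the enumerated sum both equal the unordered [esum] over all
    pairs. Finiteness along the enumeration [e] therefore makes every row sum finite, and one [S]
    serves for both. *)
Lemma ge0_double_series (a : nat * nat -> R) (e : nat -> nat * nat) :
  set_bij setT setT e -> (forall k, 0 <= a k) ->
  (\sum_(0 <= k <oo) (a (e k))%:E < +oo)%E ->
  exists (s : nat -> R) (S : R),
    [/\ forall i, (fun N => \sum_(j < N) a (i, (j : nat))) @ \oo --> s i,
        (fun N => \sum_(i < N) s i) @ \oo --> S &
        (fun N => \sum_(k < N) a (e k)) @ \oo --> S].
Proof.
move=> be a0 afin.
pose s i : \bar R := (\sum_(0 <= j <oo) (a (i, j))%:E)%E.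
have s0 i : (0 <= s i)%E by apply: nneseries_ge0 => *; rewrite lee_fin.
have eS : (\sum_(0 <= i <oo) s i = \sum_(0 <= k <oo) (a (e k))%:E)%E.
  rewrite nneseries_esumT// nneseries_esumT; last by move=> k; rewrite lee_fin.
  rewrite (eq_esum (b := fun i => \esum_(j in setT) (a (i, j))%:E)); last first.
    by move=> i _; rewrite /s nneseries_esumT// => k; rewrite lee_fin.
  rewrite (esum_esum (J := fun=> setT)); last by move=> *; rewrite lee_fin.
  rewrite (_ : _ `*`` _ = setT); last by apply/seteqP; split.
  by rewrite (@reindex_esum _ _ _ _ _ e _ be); apply: eq_esum => k _; rewrite -surjective_pairing.
have S0 : (0 <= \sum_(0 <= k <oo) (a (e k))%:E)%E.
  by apply: nneseries_ge0 => *; rewrite lee_fin.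
have sfin i : s i \is a fin_num.
  rewrite ge0_fin_numE// (le_lt_trans _ afin)// -eS.
  exact: nneseries_term_le.
exists (fine \o s), (fine (\sum_(0 <= k <oo) (a (e k))%:E)%E); split => [i||].
- apply: (ge0_series_cvg (u := fun j => a (i, j))) => //.
  by rewrite /= fineK.
- apply: ge0_series_cvg => [k|]; first by rewrite /= fine_ge0.
  under eq_eseriesr do rewrite /= fineK//.
  by rewrite eS fineK// ge0_fin_numE.
- apply: (ge0_series_cvg (u := fun k => a (e k))) => //.
  by rewrite fineK// ge0_fin_numE.
Qed.

(** Apply [ge0_double_series] to the nonnegative arrays (|z| + z)/2 and (|z| - z)/2, both dominated
    by |z|, and subtract. In the application the limits [Zi] and [Z] come from weak-* convergence
    and [Z'] from the sum of the flattened series. *)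
Lemma double_series (z : nat * nat -> R) (e : nat -> nat * nat)
    (Zi : nat -> R) (Z Z' : R) :
  set_bij setT setT e ->
  (\sum_(0 <= k <oo) `|z (e k)|%:E < +oo)%E ->
  (forall i, (fun N => \sum_(j < N) z (i, (j : nat))) @ \oo --> Zi i) ->
  (fun N => \sum_(i < N) Zi i) @ \oo --> Z ->
  (fun N => \sum_(k < N) z (e k)) @ \oo --> Z' -> Z = Z'.
Proof.
move=> be zfin zi zZ zZ'.
have [||s [S [si sS sS']]] := @ge0_double_series (fun k => (`|z k| + z k) / 2) _ be.
- by move=> k; rewrite divr_ge0// -lerBlDr sub0r -normrN ler_norm.
- apply: le_lt_trans zfin; apply: lee_nneseries => k _; rewrite lee_fin.
    by rewrite divr_ge0// -lerBlDr sub0r -normrN ler_norm.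
  by have := ler_norm (z (e k)); lra.
have [||t [T [ti tT tT']]] := @ge0_double_series (fun k => (`|z k| - z k) / 2) _ be.
- by move=> k; rewrite divr_ge0// subr_ge0 ler_norm.
- apply: le_lt_trans zfin; apply: lee_nneseries => k _; rewrite lee_fin.
    by rewrite divr_ge0// subr_ge0 ler_norm.
  by have := ler_norm (- z (e k)); rewrite normrN; lra.
have zE k : z k = (`|z k| + z k) / 2 - (`|z k| - z k) / 2 by lra.
have subE (p q r : nat -> R) (P Q L : R) : (forall k, r k = p k - q k) ->
    (fun N => \sum_(k < N) p k) @ \oo --> P ->
    (fun N => \sum_(k < N) q k) @ \oo --> Q ->
    (fun N => \sum_(k < N) r k) @ \oo --> L -> L = P - Q.
  move=> rE pP qQ rL; apply: cvg_unique rL _ => //.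
  rewrite [X in X @ _](_ : _ =
    (fun N => \sum_(k < N) p k - \sum_(k < N) q k)); first exact: cvgB.
  by apply/funext => N; rewrite -sumrB; apply: eq_bigr => k _; rewrite rE.
have ZiE i : Zi i = s i - t i.
  by apply: (subE (fun j => (`|z (i, j)| + z (i, j)) / 2)
    (fun j => (`|z (i, j)| - z (i, j)) / 2) (fun j => z (i, j))) => //.
transitivity (S - T); first exact: (subE s t Zi).
by apply/esym; apply: (subE (fun k => (`|z (e k)| + z (e k)) / 2)
  (fun k => (`|z (e k)| - z (e k)) / 2) (fun k => z (e k))) => //.
Qed.

(** Hoelder's inequality for the counting measure, with the conjugate exponent of [v] written as
    [(1 - v^-1)^-1], whose inverse is the outer exponent on the right. In use, [x] consists of the
    moduli of the coefficients and [b] of the volumes of the cubes. *)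
Lemma hoelder_series x b (v : R) : 1 < v ->
  (forall k, 0 <= x k) -> (forall k, 0 <= b k) ->
  (\sum_(0 <= k <oo) (x k * b k `^ (1 - v^-1))%:E <=
   (\sum_(0 <= k <oo) (x k `^ v)%:E) `^ v^-1 *
   (\sum_(0 <= k <oo) (b k)%:E) `^ (1 - v^-1))%E.
Proof.
move=> v1 x0 b0.
have v0 : 0 < v by rewrite (lt_trans ltr01).
have v1' : 0 < 1 - v^-1 by rewrite subr_gt0 invf_lt1.
have := @hoelder _ nat R counting x (fun k => b k `^ (1 - v^-1)) v
  (1 - v^-1)^-1 (fun _ _ _ => I) (fun _ _ _ => I) v0.
rewrite invr_gt0 invrK subrKC => /(_ v1' erefl).
rewrite !Lnorm_counting ?invr_gt0// invr1 invrK poweRe1; last first.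
  by apply: nneseries_ge0 => *; rewrite poweR_ge0.
congr (_ <= _ `^ _ * _ `^ _)%E; apply: eq_eseriesr => k _ /=.
- by rewrite powRr1// ger0_norm// mulr_ge0 ?powR_ge0.
- by rewrite ger0_norm.
- by rewrite ger0_norm ?powR_ge0// -powRrM mulfV ?gt_eqF// powRr1.
Qed.

End real_series.

(** * Absolutely convergent series in L^1 *)

Section L1_complete.
Context d (T : measurableType d) (R : realType).
Variables (mu : {measure set T -> \bar R}) (D : set T) (mD : measurable D).
Local Open Scope ereal_scope.

(** The series of moduli [g] has finite integral by monotone convergence, so it is finite almost
    everywhere, and there the partial sums converge. As [g] also dominates them, dominated
    convergence turns pointwise into L^1 convergence. *)
Lemma L1_series (u : nat -> T -> R) : (forall k, measurable_fun D (u k)) ->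
  \sum_(0 <= k <oo) \int[mu]_(x in D) `|u k x|%:E < +oo ->
  exists2 h : T -> R, mu.-integrable D (EFin \o h) &
    (fun N => \int[mu]_(x in D) `|h x - \sum_(k < N) u k x|%:E) @ \oo --> 0.
Proof.
move=> mu_ ufin.
pose F N x : \bar R := (\sum_(k < N) u k x)%:E.
have mF N : measurable_fun D (F N).
  by apply/measurable_EFinP; exact: measurable_sum.
pose g x : \bar R := \sum_(0 <= k <oo) `|u k x|%:E.
have mabs k : measurable_fun D (fun x => `|u k x|%:E).
  by apply/measurable_EFinP; exact: measurableT_comp.
have g0 x : 0 <= g x by apply: nneseries_ge0 => *.
have ig : mu.-integrable D g.
  apply/integrableP; split.
    by apply: ge0_emeasurable_sum => // k x Dx _; rewrite lee_fin.
  under eq_integral do rewrite gee0_abs//.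
  rewrite integral_nneseries//.
have gfin := integrable_ae mD ig.
(* The limsup makes the limit measurable without first removing the null set
   on which the series diverges. *)
pose h0 x : \bar R := limn_esup (F ^~ x).
have Fh x : g x \is a fin_num -> F ^~ x @ \oo --> (fine (h0 x))%:E.
  move=> gx.
  have : cvgn (series (fun k => u k x)).
    apply: normed_cvg.
    have := @ge0_series_cvg R (fun k => `|u k x|%R) (fine (g x)).
    rewrite fineK// => /(_ (fun k => normr_ge0 _) erefl).
    under eq_cvg do rewrite -(big_mkord xpredT (fun k => `|u k x|%R)).
    by move=> h; apply/cvg_ex; exists (fine (g x)).
  move=> /cvg_ex[l hl].
  have : F ^~ x @ \oo --> l%:E.
    apply: cvg_EFin; first exact: nearW.
    rewrite (_ : _ \o _ = series (fun k => u k x))//.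
    by apply/funext => N; rewrite /series/= big_mkord.
  by move=> Fl; rewrite /h0 is_cvg_limn_esupE ?(cvg_lim _ Fl)//; apply/cvg_ex; exists l%:E.
have mh : measurable_fun D (EFin \o (fine \o h0)).
  apply/measurable_EFinP; apply: measurableT_comp => //.
  exact: measurable_fun_limn_esup.
have [] := @dominated_convergence _ _ _ mu D mD F _ g mF mh _ ig _.
- by apply: filterS gfin => x + Dx => /(_ Dx) /Fh.
- apply/nearW => x N Dx; rewrite /F.
  rewrite (le_trans (y := \sum_(k < N) `|u k x|%:E))//.
    by rewrite sumEFin lee_fin ler_norm_sum.
  rewrite -(big_mkord xpredT (fun k => `|u k x|%:E)).
  by apply: nneseries_lim_ge => *; rewrite lee_fin.
move=> ih cv _; exists (fine \o h0) => //.
apply: cvg_trans cv; apply: near_eq_cvg; apply/nearW => N /=.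
by apply: eq_integral => x _; rewrite /= distrC.
Qed.

End L1_complete.

(** * Volumes of cubes *)

Section cube_measure.
Context (R : realType) (n : nat).
Local Notation mu := (lebesgue_measure_n R n).
Implicit Types Q : cube R n.

Lemma cube_set_measure Q :
  measurable (cube_set Q) /\ mu (cube_set Q) = (side Q ^+ n)%:E.
Proof.
have [|mQ ->] := @lebesgue_measure_n_box R n (fun i => [set` Interval
   (BSide (left_closed Q i) (corner Q i))
   (BSide (~~ right_closed Q i) (corner Q i + side Q))]).
  by move=> i; exact: measurable_itv.
split=> //.
under eq_bigr => i _.
  rewrite lebesgue_measure_itv /= lte_fin ltrDl side_gt0 -EFinD addrAC subrr add0r.
  over.
by rewrite prodEFin prodr_const card_ord.
Qed.

Lemma measurable_cube Q : measurable (cube_set Q).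
Proof. exact: (cube_set_measure Q).1. Qed.

Lemma volumeE Q : volume Q = side Q ^+ n.
Proof. by rewrite /volume (cube_set_measure Q).2. Qed.

Lemma measure_cube Q : mu (cube_set Q) = (volume Q)%:E.
Proof. by rewrite volumeE (cube_set_measure Q).2. Qed.

Lemma volume_gt0 Q : 0 < volume Q.
Proof. by rewrite volumeE exprn_gt0// side_gt0. Qed.

(** Disjointness is assumed for topological interiors, whereas volumes are known for cubes. Opening
    all faces gives a cube of the same volume that lies inside the interior. *)
Definition open_cube Q : cube R n :=
  Cube (corner Q) (fun=> false) (fun=> false) (side_gt0 Q).

Lemma open_cube_sub Q : cube_set (open_cube Q) `<=` cube_set Q.
Proof.
move=> x /= xQ i; have := xQ i; apply: subset_itv => /=.
  by case: left_closed; rewrite bnd_simp.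
by case: right_closed; rewrite bnd_simp.
Qed.

Lemma open_cube_interior Q :
  cube_set (open_cube Q) `<=` interior_Rn (cube_set Q).
Proof.
move=> x xQ; pose c i := Num.min ((tnth x i : R) - corner Q i)
  (corner Q i + side Q - (tnth x i : R)).
(* The radius is the distance from [x] to the nearest face, capped at 1, the starting value of the
   minimum. *)
exists (\big[Num.min/1]_(i < n) c i) => [|y yx].
  apply/bigmin_gtP; split => // i _.
  by have := xQ i; rewrite in_itv/= => /andP[? ?]; rewrite lt_min !subr_gt0; apply/andP.
apply: open_cube_sub => i; rewrite in_itv /=.
have : `|(tnth y i : R) - (tnth x i : R)| < c i.
  by rewrite (lt_le_trans (yx i))//; exact: bigmin_le_cond.
rewrite lt_min ltr_norml ltr_distl => /andP[/andP[h1 _] /andP[_ h2]].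
lra.
Qed.

(** The cubes may overlap along their faces, so additivity is applied to their open versions, which
    are pairwise disjoint and have the same volumes. *)
Lemma esum_volume (Q0 : cube R n) J (Q : nat -> cube R n) :
  disjoint_cubes Q0 J Q -> (\esum_(j in J) (volume (Q j))%:E <= (volume Q0)%:E)%E.
Proof.
move=> [QQ0 tQ].
have mQ j : measurable (cube_set (open_cube (Q j))) by exact: measurable_cube.
have tI : trivIset J (fun j => cube_set (open_cube (Q j))).
  move=> i j Ji Jj [x [xi xj]]; apply: tQ => //.
  by exists x; split; exact: open_cube_interior.
have := @measure_bigcup _ _ _ mu J _ (fun j _ => mQ j) tI.
rewrite nneseries_esum// set_mem_set.
rewrite (eq_esum (b := fun j => (volume (Q j))%:E)); last first.
  by move=> j _; have := measure_cube (open_cube (Q j)); rewrite !volumeE.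
move=> <-; rewrite -measure_cube le_measure// ?inE.
- exact: bigcup_measurable.
- exact: measurable_cube.
- by move=> x [j Jj] /open_cube_sub; exact: QQ0.
Qed.

End cube_measure.

(** * Complex moduli and series *)

Section complex_modulus.
Context (R : realType).
Implicit Types z : R[i].

Lemma cabsE z : cabs z = Num.sqrt (complex.Re z ^+ 2 + complex.Im z ^+ 2).
Proof. by case: z. Qed.

Lemma cabs_ge0 z : 0 <= cabs z.
Proof. by rewrite cabsE sqrtr_ge0. Qed.

Lemma normr_Re_le_cabs z : `|complex.Re z| <= cabs z.
Proof. by rewrite cabsE -sqrtr_sqr ler_wsqrtr// lerDl sqr_ge0. Qed.

Lemma normr_Im_le_cabs z : `|complex.Im z| <= cabs z.
Proof. by rewrite cabsE -sqrtr_sqr ler_wsqrtr// lerDr sqr_ge0. Qed.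

Lemma cabs_le z : cabs z <= `|complex.Re z| + `|complex.Im z|.
Proof.
rewrite cabsE -[leRHS]ger0_norm ?addr_ge0// -sqrtr_sqr ler_wsqrtr//.
rewrite sqrrD !real_normK ?num_real// lerD2r lerDl.
by rewrite mulrn_wge0// mulr_ge0.
Qed.

Lemma cabs_real (r : R) : cabs (real_complex R r) = `|r|.
Proof. by rewrite cabsE /= expr0n addr0 sqrtr_sqr. Qed.

Lemma cabsD z1 z2 : cabs (z1 + z2) <= cabs z1 + cabs z2.
Proof. exact: le_normcD. Qed.

Lemma cabsM z1 z2 : cabs (z1 * z2) = cabs z1 * cabs z2.
Proof. exact: ComplexField.Normc.normcM. Qed.

Lemma cabsN z : cabs (- z) = cabs z.
Proof. exact: normcN. Qed.

Lemma cabsB z1 z2 : cabs (z1 - z2) <= cabs z1 + cabs z2.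
Proof. by rewrite -(cabsN z2) cabsD. Qed.

Lemma cReD z1 z2 : complex.Re (z1 + z2) = complex.Re z1 + complex.Re z2.
Proof. by case: z1 z2 => [? ?] []. Qed.

Lemma cImD z1 z2 : complex.Im (z1 + z2) = complex.Im z1 + complex.Im z2.
Proof. by case: z1 z2 => [? ?] []. Qed.

Lemma cReN z : complex.Re (- z) = - complex.Re z.
Proof. by case: z. Qed.

Lemma cImN z : complex.Im (- z) = - complex.Im z.
Proof. by case: z. Qed.

Lemma cReM z1 z2 : complex.Re (z1 * z2) =
  complex.Re z1 * complex.Re z2 - complex.Im z1 * complex.Im z2.
Proof. by case: z1 z2 => [? ?] []. Qed.

Lemma cImM z1 z2 : complex.Im (z1 * z2) =
  complex.Re z1 * complex.Im z2 + complex.Im z1 * complex.Re z2.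
Proof. by case: z1 z2 => [? ?] []. Qed.

Lemma cRe_sum N (z : nat -> R[i]) :
  complex.Re (\sum_(k < N) z k) = \sum_(k < N) complex.Re (z k).
Proof. exact: (big_morph _ cReD). Qed.

Lemma cIm_sum N (z : nat -> R[i]) :
  complex.Im (\sum_(k < N) z k) = \sum_(k < N) complex.Im (z k).
Proof. exact: (big_morph _ cImD). Qed.

Lemma complex_eqP z1 z2 : complex.Re z1 = complex.Re z2 ->
  complex.Im z1 = complex.Im z2 -> z1 = z2.
Proof. by case: z1 z2 => [? ?] [? ?] /= -> ->. Qed.

Lemma ccvgP (z : nat -> R[i]) l : ccvg z l <->
  (fun N => complex.Re (z N)) @ \oo --> complex.Re l /\
  (fun N => complex.Im (z N)) @ \oo --> complex.Im l.
Proof.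
split=> [zl|[zr zi]].
- split; apply/cvgrPdist_le => e e0; move/cvgr0Pnorm_le : zl => /(_ _ e0);
    apply: filterS => N; rewrite ger0_norm ?cabs_ge0//; apply: le_trans;
    rewrite distrC.
  + by rewrite -cReN -cReD normr_Re_le_cabs.
  + by rewrite -cImN -cImD normr_Im_le_cabs.
- have : (fun N => `|complex.Re (z N) - complex.Re l| +
      `|complex.Im (z N) - complex.Im l|) @ \oo -->
      `|complex.Re l - complex.Re l| + `|complex.Im l - complex.Im l|.
    by apply: cvgD; apply: cvg_norm; apply: cvgB => //; exact: cvg_cst.
  rewrite !subrr normr0 addr0 => h; apply: squeeze_cvgr (cvg_cst 0) h.
  apply: nearW => N; rewrite cabs_ge0 (le_trans (cabs_le _))//.
  by rewrite cReD cReN cImD cImN.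
Qed.

Lemma double_cseries (z : nat * nat -> R[i]) (e : nat -> nat * nat)
    (Zi : nat -> R[i]) (Z Z' : R[i]) :
  set_bij setT setT e ->
  (\sum_(0 <= k <oo) (cabs (z (e k)))%:E < +oo)%E ->
  (forall i, ccvg (fun N => \sum_(j < N) z (i, (j : nat))) (Zi i)) ->
  ccvg (fun N => \sum_(i < N) Zi i) Z ->
  ccvg (fun N => \sum_(k < N) z (e k)) Z' -> Z = Z'.
Proof.
move=> be zfin zi /ccvgP[zr zim] /ccvgP[zr' zim'].
apply: complex_eqP.
- apply: (@double_series R (fun k => complex.Re (z k)) e
    (fun i => complex.Re (Zi i)) _ _ be).
  + apply: le_lt_trans zfin; apply: lee_nneseries => k _; rewrite lee_fin//.
    exact: normr_Re_le_cabs.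
  + move=> i; have /ccvgP[+ _] := zi i.
    under eq_cvg do rewrite (cRe_sum _ (fun j => z (i, j))).
    exact.
  + by move: zr; under eq_cvg do rewrite cRe_sum.
  + by move: zr'; under eq_cvg do rewrite (cRe_sum _ (z \o e)).
- apply: (@double_series R (fun k => complex.Im (z k)) e
    (fun i => complex.Im (Zi i)) _ _ be).
  + apply: le_lt_trans zfin; apply: lee_nneseries => k _; rewrite lee_fin//.
    exact: normr_Im_le_cabs.
  + move=> i; have /ccvgP[_ +] := zi i.
    under eq_cvg do rewrite (cIm_sum _ (fun j => z (i, j))).
    exact.
  + by move: zim; under eq_cvg do rewrite cIm_sum.
  + by move: zim'; under eq_cvg do rewrite (cIm_sum _ (z \o e)).
Qed.

End complex_modulus.

(** * Complex integrals *)

Section complex_integral.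
Context (R : realType) (n : nat) (D : set (Rn R n)).
Hypothesis mD : measurable D.
Local Notation mu := (lebesgue_measure_n R n).
Implicit Types f g h : Rn R n -> R[i].

Lemma cmeasurable_cabs f : cmeasurable D f -> measurable_fun D (fun x => cabs (f x)).
Proof.
move=> [mr mi].
rewrite (_ : (fun x => _) = (@Num.sqrt R) \o
  (fun x => complex.Re (f x) ^+ 2 + complex.Im (f x) ^+ 2)); last first.
  by apply/funext => x; rewrite /= cabsE.
apply: measurableT_comp; first by apply: continuous_measurable_fun; exact: sqrt_continuous.
by apply: measurable_funD; exact: measurable_funX.
Qed.

Lemma cmeasurableM f g : cmeasurable D f -> cmeasurable D g ->
  cmeasurable D (fun x => f x * g x).
Proof.
move=> [? ?] [? ?]; split.
- by under eq_fun do rewrite cReM; apply: measurable_funB; exact: measurable_funM.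
- by under eq_fun do rewrite cImM; apply: measurable_funD; exact: measurable_funM.
Qed.

Lemma cmeasurable_cst (c : R[i]) : cmeasurable D (fun=> c).
Proof. by split; exact: measurable_cst. Qed.

Lemma cmeasurableB f g : cmeasurable D f -> cmeasurable D g ->
  cmeasurable D (fun x => f x - g x).
Proof.
move=> [? ?] [? ?]; split.
- by under eq_fun do rewrite cReD cReN; apply: measurable_funB.
- by under eq_fun do rewrite cImD cImN; apply: measurable_funB.
Qed.

Lemma cmeasurable_sum N (u : nat -> Rn R n -> R[i]) :
  (forall k, cmeasurable D (u k)) ->
  cmeasurable D (fun x => \sum_(k < N) u k x).
Proof.
move=> mu_; split.
- under eq_fun do rewrite (cRe_sum _ (fun k => u k _)).
  by apply: measurable_sum => k; case: (mu_ k).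
- under eq_fun do rewrite (cIm_sum _ (fun k => u k _)).
  by apply: measurable_sum => k; case: (mu_ k).
Qed.

Lemma Lp_norm1E f : Lp_norm D 1 f = (\int[mu]_(x in D) (cabs (f x))%:E)%E.
Proof.
rewrite /Lp_norm Lnorm1 [RHS]integral_mkcond; apply: eq_integral => x _ /=.
by rewrite !patchE; case: ifPn => _ /=; rewrite ?normr0// ger0_norm ?cabs_ge0.
Qed.

Lemma measurable_cabsE f : cmeasurable D f ->
  measurable_fun D (fun x => (cabs (f x))%:E).
Proof. by move=> /cmeasurable_cabs mf; exact/measurable_EFinP. Qed.

Lemma integrable_Re f : Lp D 1 f ->
  mu.-integrable D (EFin \o (fun x => complex.Re (f x))).
Proof.
move=> [mf]; rewrite Lp_norm1E => foo; apply/integrableP; split.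
  by apply/measurable_EFinP; case: mf.
apply: le_lt_trans foo; apply: ge0_le_integral => //=.
- by do 2 apply: measurableT_comp => //; case: mf.
- exact: measurable_cabsE.
- by move=> x _; rewrite lee_fin normr_Re_le_cabs.
Qed.

Lemma integrable_Im f : Lp D 1 f ->
  mu.-integrable D (EFin \o (fun x => complex.Im (f x))).
Proof.
move=> [mf]; rewrite Lp_norm1E => foo; apply/integrableP; split.
  by apply/measurable_EFinP; case: mf.
apply: le_lt_trans foo; apply: ge0_le_integral => //=.
- by do 2 apply: measurableT_comp => //; case: mf.
- exact: measurable_cabsE.
- by move=> x _; rewrite lee_fin normr_Im_le_cabs.
Qed.

Lemma integral_cabs_le f : cmeasurable D f ->
  (\int[mu]_(x in D) (cabs (f x))%:E <=
   \int[mu]_(x in D) `|complex.Re (f x)|%:E +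
   \int[mu]_(x in D) `|complex.Im (f x)|%:E)%E.
Proof.
move=> mf; have [mr mi] := mf.
rewrite -ge0_integralD//; last 2 first.
- by apply/measurable_EFinP; exact: measurableT_comp.
- by apply/measurable_EFinP; exact: measurableT_comp.
apply: ge0_le_integral => //.
- by move=> x _; rewrite lee_fin cabs_ge0.
- exact: measurable_cabsE.
- by apply: emeasurable_funD; apply/measurable_EFinP; exact: measurableT_comp.
- by move=> x _; rewrite -EFinD lee_fin cabs_le.
Qed.

Lemma Lp1_integrable f :
  mu.-integrable D (EFin \o (fun x => complex.Re (f x))) ->
  mu.-integrable D (EFin \o (fun x => complex.Im (f x))) -> Lp D 1 f.
Proof.
move=> /integrableP[/measurable_EFinP mr rfin] /integrableP[/measurable_EFinP mi ifin].
by split=> //; rewrite Lp_norm1E (le_lt_trans (integral_cabs_le _))// lte_add_pinfty.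
Qed.

Lemma Lp1B f g : Lp D 1 f -> Lp D 1 g -> Lp D 1 (fun x => f x - g x).
Proof.
move=> Lf Lg; apply: Lp1_integrable.
- rewrite (_ : _ \o _ = (EFin \o (fun x => complex.Re (f x))) \-
      (EFin \o (fun x => complex.Re (g x))))%E.
    by apply: integrableB => //; exact: integrable_Re.
  by apply/funext => x /=; rewrite cReD cReN.
- rewrite (_ : _ \o _ = (EFin \o (fun x => complex.Im (f x))) \-
      (EFin \o (fun x => complex.Im (g x))))%E.
    by apply: integrableB => //; exact: integrable_Im.
  by apply/funext => x /=; rewrite cImD cImN.
Qed.

Lemma Lp1_sum N (u : nat -> Rn R n -> R[i]) : (forall k, Lp D 1 (u k)) ->
  Lp D 1 (fun x => \sum_(k < N) u k x).
Proof.
move=> Lu; apply: Lp1_integrable.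
- rewrite (_ : _ \o _ = (fun x => \sum_(k < N) (complex.Re (u k x))%:E))%E.
    by apply: integrable_sum => // k _; exact: integrable_Re.
  by apply/funext => x /=; rewrite (cRe_sum _ (fun k => u k x)) sumEFin.
- rewrite (_ : _ \o _ = (fun x => \sum_(k < N) (complex.Im (u k x))%:E))%E.
    by apply: integrable_sum => // k _; exact: integrable_Im.
  by apply/funext => x /=; rewrite (cIm_sum _ (fun k => u k x)) sumEFin.
Qed.

Lemma cintegralB f g : Lp D 1 f -> Lp D 1 g ->
  cintegral D (fun x => f x - g x) = cintegral D f - cintegral D g.
Proof.
move=> Lf Lg; apply: complex_eqP; rewrite /= ?cReD ?cImD ?cReN ?cImN /=.
- under eq_Rintegral do rewrite cReD cReN.
  by rewrite RintegralB//; exact: integrable_Re.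
- under eq_Rintegral do rewrite cImD cImN.
  by rewrite RintegralB//; exact: integrable_Im.
Qed.

Lemma cintegralD f g : Lp D 1 f -> Lp D 1 g ->
  cintegral D (fun x => f x + g x) = cintegral D f + cintegral D g.
Proof.
move=> Lf Lg; apply: complex_eqP; rewrite /= ?cReD ?cImD /=.
- under eq_Rintegral do rewrite cReD.
  by rewrite RintegralD//; exact: integrable_Re.
- under eq_Rintegral do rewrite cImD.
  by rewrite RintegralD//; exact: integrable_Im.
Qed.

Lemma cintegral0 : cintegral D (fun=> 0) = 0.
Proof. by rewrite /cintegral /= !Rintegral_cst// !mul0r. Qed.

Lemma cintegral_sum N (u : nat -> Rn R n -> R[i]) : (forall k, Lp D 1 (u k)) ->
  cintegral D (fun x => \sum_(k < N) u k x) = \sum_(k < N) cintegral D (u k).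
Proof.
move=> Lu; elim: N => [|N IH].
  by under eq_fun do rewrite big_ord0; rewrite cintegral0 big_ord0.
under eq_fun do rewrite big_ord_recr/=.
by rewrite cintegralD ?IH ?big_ord_recr//; exact: Lp1_sum.
Qed.

Lemma cintegralZ (c : R[i]) f : Lp D 1 f ->
  cintegral D (fun x => c * f x) = c * cintegral D f.
Proof.
move=> Lf; have ir := integrable_Re Lf; have ii := integrable_Im Lf.
have iZ (k : R) (g : Rn R n -> R) : mu.-integrable D (EFin \o g) ->
    mu.-integrable D (EFin \o (fun x => k * g x)).
  move=> /(integrableZl mD k); exact: eq_integrable.
apply: complex_eqP; rewrite ?cReM ?cImM /=.
- under eq_Rintegral do rewrite cReM.
  by rewrite RintegralB// ?RintegralZl//; exact: iZ.
- under eq_Rintegral do rewrite cImM.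
  by rewrite RintegralD// ?RintegralZl//; exact: iZ.
Qed.

(** The factor 2 comes from bounding the real and imaginary parts separately; the estimates below
    only ask for some finite constant. *)
Lemma cabs_cintegral_le f : Lp D 1 f ->
  ((cabs (cintegral D f))%:E <= 2%:E * Lp_norm D 1 f)%E.
Proof.
move=> Lf; have [mf ffin] := Lf; rewrite Lp_norm1E.
apply: (@le_trans _ _ (\int[mu]_(x in D) `|complex.Re (f x)|%:E +
   \int[mu]_(x in D) `|complex.Im (f x)|%:E)%E).
  apply: (@le_trans _ _ (`|\int[mu]_(x in D) complex.Re (f x)| +
      `|\int[mu]_(x in D) complex.Im (f x)|)%:E).
    by rewrite lee_fin (le_trans (cabs_le _)).
  rewrite EFinD leeD// EFin_normr_Rintegral//; try exact: integrable_Re;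
    try exact: integrable_Im.
  - by apply: le_abse_integral => //; apply/measurable_EFinP; case: mf.
  - by apply: le_abse_integral => //; apply/measurable_EFinP; case: mf.
rewrite mule_natl mule2n; case: (mf) => mr mi; apply: leeD.
- apply: ge0_le_integral => //.
  + by apply/measurable_EFinP; exact: measurableT_comp.
  + exact: measurable_cabsE.
  + by move=> x _; rewrite lee_fin normr_Re_le_cabs.
- apply: ge0_le_integral => //.
  + by apply/measurable_EFinP; exact: measurableT_comp.
  + exact: measurable_cabsE.
  + by move=> x _; rewrite lee_fin normr_Im_le_cabs.
Qed.

Lemma Lp_norm1M_le f g (M : R) : cmeasurable D f -> cmeasurable D g -> 0 <= M ->
  {ae mu, forall x, D x -> cabs (g x) <= M} ->
  (Lp_norm D 1 (fun x => (f x * g x)%R) <= M%:E * Lp_norm D 1 f)%E.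
Proof.
move=> mf mg M0 gM; rewrite !Lp_norm1E -ge0_integralZl_EFin//; last 2 first.
- by move=> x _; rewrite lee_fin cabs_ge0.
- exact: measurable_cabsE.
apply: ae_ge0_le_integral => //.
- by move=> x _; rewrite lee_fin cabs_ge0.
- by apply: measurable_cabsE; exact: cmeasurableM.
- by move=> x _; rewrite -EFinM lee_fin mulr_ge0// cabs_ge0.
- by apply: measurable_funeM; exact: measurable_cabsE.
- apply: filterS gM => x + Dx => /(_ Dx) gx.
  by rewrite -EFinM lee_fin cabsM mulrC ler_wpM2r// cabs_ge0.
Qed.

Lemma Lp1M f g (M : R) : Lp D 1 f -> cmeasurable D g -> 0 <= M ->
  {ae mu, forall x, D x -> cabs (g x) <= M} -> Lp D 1 (fun x => f x * g x).
Proof.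
move=> [mf ffin] mg M0 gM; split; first exact: cmeasurableM.
rewrite (le_lt_trans (Lp_norm1M_le _ _ M0 _))//.
by rewrite lte_mul_pinfty ?lee_fin// fin_numE.
Qed.

End complex_integral.

(** * Pairing L^1 with bounded functions *)

Section L1_Linfty_duality.
Context (R : realType) (n : nat) (D : set (Rn R n)).
Hypothesis mD : measurable D.
Local Notation mu := (lebesgue_measure_n R n).
Implicit Types f g h : Rn R n -> R[i].

(** The norm with exponent +oo is the essential supremum only when the whole space has positive
    measure, and 0 otherwise; hence the first hypothesis. *)
Lemma Linf_ae_le f : (0 < mu setT)%E -> Lp D +oo f ->
  {ae mu, forall x, D x -> cabs (f x) <= fine (Lp_norm D +oo f)}.
Proof.
move=> muT [mf foo].
have ffin : Lp_norm D +oo f \is a fin_num by rewrite ge0_fin_numE// Lnorm_ge0.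
have := ess_sup_ge mu (abse \o (EFin \o (fun x => cabs (f x)) \_ D)).
move: ffin; rewrite /Lp_norm unlock muT => ffin.
apply: filterS => x + Dx; rewrite -lee_fin fineK//; apply: le_trans.
by rewrite /= patchE mem_set// lee_fin ler_norm.
Qed.

Lemma Linf_ae_bounded f : (0 < mu setT)%E -> Lp D +oo f ->
  exists2 M : R, 0 <= M & {ae mu, forall x, D x -> cabs (f x) <= M}.
Proof.
move=> muT Lf; exists (fine (Lp_norm D +oo f)); last exact: Linf_ae_le.
by rewrite fine_ge0// Lnorm_ge0.
Qed.

Lemma Linf_indic (E : set (Rn R n)) : measurable E ->
  Lp D +oo (fun x => real_complex R (\1_E x)).
Proof.
move=> mE; split.
  split => /=; last exact: measurable_cst.
  exact: measurable_indic.
rewrite /Lp_norm unlock; case: ifP => // _.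
apply: (@le_lt_trans _ _ 1%E); last exact: ltry.
apply/ess_supP/nearW => x /=; rewrite lee_fin patchE.
case: ifPn => _ /=; last by rewrite normr0.
by rewrite expr0n addr0 sqrtr_sqr normr_id indicE; case: (x \in E); rewrite ?normr0 ?normr1.
Qed.

Lemma L1_cseries (u : nat -> Rn R n -> R[i]) :
  (forall k, cmeasurable D (u k)) ->
  (\sum_(0 <= k <oo) Lp_norm D 1 (u k) < +oo)%E ->
  exists2 h, Lp D 1 h & (fun N => Lp_norm D 1
    (fun x => (h x - \sum_(k < N) u k x)%R)) @ \oo --> 0%E.
Proof.
move=> mu_ ufin.
have mabs k : measurable_fun D (fun x => (cabs (u k x))%:E).
  exact: measurable_cabsE.
have [k||hr ihr hrE] := @L1_series _ _ _ mu D mD (fun k x => complex.Re (u k x)).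
- by case: (mu_ k).
- apply: le_lt_trans ufin; apply: lee_nneseries => k _.
    by move=> _; apply: integral_ge0.
  rewrite Lp_norm1E//; apply: ge0_le_integral => //.
  + by case: (mu_ k) => ? _; apply/measurable_EFinP; exact: measurableT_comp.
  + by move=> x _; rewrite lee_fin normr_Re_le_cabs.
have [k||hi ihi hiE] := @L1_series _ _ _ mu D mD (fun k x => complex.Im (u k x)).
- by case: (mu_ k).
- apply: le_lt_trans ufin; apply: lee_nneseries => k _.
    by move=> _; apply: integral_ge0.
  rewrite Lp_norm1E//; apply: ge0_le_integral => //.
  + by case: (mu_ k) => _ ?; apply/measurable_EFinP; exact: measurableT_comp.
  + by move=> x _; rewrite lee_fin normr_Im_le_cabs.
exists (fun x => Complex (hr x) (hi x)); first exact: Lp1_integrable.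
have hE : (fun N => \int[mu]_(x in D) `|hr x - \sum_(k < N) complex.Re (u k x)|%:E +
    \int[mu]_(x in D) `|hi x - \sum_(k < N) complex.Im (u k x)|%:E)%E @ \oo --> 0%E.
  by rewrite -[0%E]adde0; apply: cvgeD.
apply: squeeze_cvge (cvg_cst 0%E) hE.
apply: nearW => N; rewrite Lnorm_ge0/= Lp_norm1E//.
have mB : cmeasurable D (fun x => Complex (hr x) (hi x) - \sum_(k < N) u k x).
  apply: cmeasurableB => //; last exact: cmeasurable_sum.
  by split; apply/measurable_EFinP; [case/integrableP : ihr|case/integrableP : ihi].
apply: le_trans (integral_cabs_le mD mB) _.
rewrite le_eqVlt; apply/orP; left; apply/eqP.
congr (_ + _)%E; apply: eq_integral => x _.
- by rewrite cReD cReN (cRe_sum _ (fun k => u k x)).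
- by rewrite cImD cImN (cIm_sum _ (fun k => u k x)).
Qed.

(** The difference of the two integrals has modulus at most [2 * M] times the L^1 norm of [h - F N],
    where [M] bounds [g] almost everywhere. *)
Lemma cintegralM_cvg (F : nat -> Rn R n -> R[i]) h g :
  (0 < mu setT)%E -> (forall N, Lp D 1 (F N)) -> Lp D 1 h -> Lp D +oo g ->
  (fun N => Lp_norm D 1 (fun x => (h x - F N x)%R)) @ \oo --> 0%E ->
  ccvg (fun N => cintegral D (fun x => F N x * g x))
       (cintegral D (fun x => h x * g x)).
Proof.
move=> muT LF Lh Lg hF.
have [M M0 gM] := Linf_ae_bounded muT Lg; have mg := Lg.1.
have LM f : Lp D 1 f -> Lp D 1 (fun x => f x * g x).
  by move=> Lf; exact: (Lp1M mD Lf mg M0 gM).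
have LhF N : Lp D 1 (fun x => h x - F N x) by exact: Lp1B.
pose d N := (cabs (cintegral D (fun x => F N x * g x) -
                   cintegral D (fun x => h x * g x)))%:E.
suff : (fun N => d N) @ \oo --> 0%E by move/fine_cvgP => [_].
have hF2 : (fun N => (2 * M)%:E * Lp_norm D 1 (fun x => (h x - F N x)%R))%E
    @ \oo --> 0%E.
  by rewrite -[X in _ --> X](mule0 (2 * M)%:E); exact: cvgeZl.
apply: squeeze_cvge (cvg_cst 0%E) hF2.
apply: nearW => N; rewrite lee_fin cabs_ge0/= /d.
rewrite -cabsN opprB -cintegralB//; [|exact: LM..].
under eq_fun do rewrite -mulrBl.
rewrite (le_trans (cabs_cintegral_le _ _))//; first exact: LM.
rewrite EFinM -muleA lee_pmul2l//; apply: Lp_norm1M_le => //.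
by case: (LhF N).
Qed.

(** Indicators of measurable subsets [E] of [D] are bounded, and testing with them equates the
    integrals of the real parts over every [E], and likewise those of the imaginary parts. Both
    parts then agree almost everywhere. *)
Lemma Lp_norm1_eq0 h1 h2 : Lp D 1 h1 -> Lp D 1 h2 ->
  (forall f, Lp D +oo f -> cintegral D (fun x => h1 x * f x) =
                           cintegral D (fun x => h2 x * f x)) ->
  Lp_norm D 1 (fun x => h1 x - h2 x) = 0%E.
Proof.
move=> L1 L2 h12.
have [ir1 ii1] := (integrable_Re mD L1, integrable_Im mD L1).
have [ir2 ii2] := (integrable_Re mD L2, integrable_Im mD L2).
have restr (k : Rn R n -> R) (E : set (Rn R n)) : E `<=` D -> measurable E ->
    \int[mu]_(x in D) (k x * \1_E x) = \int[mu]_(x in E) k x.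
  move=> ED mE; rewrite -[in RHS](setIidr ED) Rintegral_mkcondr.
  apply: eq_Rintegral => x _; rewrite patchE indicE.
  by case: (x \in E); rewrite ?mulr1 ?mulr0.
have fin (k : Rn R n -> R) (E : set (Rn R n)) : E `<=` D -> measurable E ->
    mu.-integrable D (EFin \o k) ->
    (\int[mu]_(x in E) (EFin \o k) x)%E = (\int[mu]_(x in E) k x)%:E.
  move=> ED mE ik; rewrite fineK//; apply: integrable_fin_num => //.
  exact: integrableS ik.
have hE E : E `<=` D -> measurable E ->
    \int[mu]_(x in E) complex.Re (h1 x) = \int[mu]_(x in E) complex.Re (h2 x) /\
    \int[mu]_(x in E) complex.Im (h1 x) = \int[mu]_(x in E) complex.Im (h2 x).
  move=> ED mE; have [] := h12 _ (Linf_indic mE).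
  rewrite -!(restr (fun x => complex.Re (_ x)) E ED mE).
  rewrite -!(restr (fun x => complex.Im (_ x)) E ED mE) => hr hi; split.
  - transitivity (\int[mu]_(x in D)
        complex.Re (h1 x * real_complex R (\1_E x))).
      by apply: eq_Rintegral => x _; rewrite cReM /= mulr0 subr0.
    by rewrite hr; apply: eq_Rintegral => x _; rewrite cReM /= mulr0 subr0.
  - transitivity (\int[mu]_(x in D)
        complex.Im (h1 x * real_complex R (\1_E x))).
      by apply: eq_Rintegral => x _; rewrite cImM /= mulr0 add0r.
    by rewrite hi; apply: eq_Rintegral => x _; rewrite cImM /= mulr0 add0r.
have aer : ae_eq mu D (EFin \o (fun x => complex.Re (h1 x)))
                      (EFin \o (fun x => complex.Re (h2 x))).
  apply: integral_ae_eq => //; first exact: measurable_int ir2.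
  by move=> E ED mE; rewrite !fin// (hE E ED mE).1.
have aei : ae_eq mu D (EFin \o (fun x => complex.Im (h1 x)))
                      (EFin \o (fun x => complex.Im (h2 x))).
  apply: integral_ae_eq => //; first exact: measurable_int ii2.
  by move=> E ED mE; rewrite !fin// (hE E ED mE).2.
rewrite Lp_norm1E// (ae_eq_integral (cst 0%E))//; first exact: integral0.
- by apply: measurable_cabsE; apply: cmeasurableB; [case: L1|case: L2].
- apply: filterS2 aer aei => x hr hi Dx /=.
  have [[hr'] [hi']] := (hr Dx, hi Dx).
  by rewrite (complex_eqP hr' hi') subrr cabs_real normr0.
Qed.

Lemma Lp_norm1_triangle f g h : cmeasurable D f -> cmeasurable D g ->
  cmeasurable D h ->
  (Lp_norm D 1 (fun x => (f x - g x)%R) <=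
   Lp_norm D 1 (fun x => (f x - h x)%R) + Lp_norm D 1 (fun x => (h x - g x)%R))%E.
Proof.
move=> mf mg mh; rewrite !Lp_norm1E// -ge0_integralD//.
- apply: ge0_le_integral => //.
  + by move=> x _; rewrite lee_fin cabs_ge0.
  + by apply: measurable_cabsE; exact: cmeasurableB.
  + by apply: emeasurable_funD; apply: measurable_cabsE; exact: cmeasurableB.
  + by move=> x _; rewrite -EFinD lee_fin -(subrKA (h x)) cabsD.
- by move=> x _; rewrite lee_fin cabs_ge0.
- by apply: measurable_cabsE; exact: cmeasurableB.
- by move=> x _; rewrite lee_fin cabs_ge0.
- by apply: measurable_cabsE; exact: cmeasurableB.
Qed.

End L1_Linfty_duality.

(** * Bounded functions belong to jn; local atoms *)

Lemma ge0_le_poweR (R : realType) (x y : \bar R) (r : R) :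
  0 <= r -> (0 <= x)%E -> (x <= y)%E -> (x `^ r <= y `^ r)%E.
Proof.
move=> r0 x0 xy; apply: gt0_ler_poweR => //; rewrite in_itv/= leey andbT//.
exact: le_trans xy.
Qed.

Lemma gt0_powRD (R : realType) (x r s : R) :
  0 < x -> x `^ (r + s) = x `^ r * x `^ s.
Proof. by move=> x0; rewrite powRD// (gt_eqF x0) implybT. Qed.

(** [fine] would send an infinite conjugate exponent to 0; the conjugate is infinite only at
    [p = 1], which [1 < p] excludes. *)
Lemma conj_exponent_ge1 (R : realType) (p : \bar R) :
  (1 < p)%E -> 1 <= conj_exponent p.
Proof.
move=> p1; have := hoelder_conj_ge1 (ltW p1); rewrite /conj_exponent.
case E : (hoelder_conjugate p) => [q| |//]; first by rewrite lee_fin.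
by move: (hoelder_conjugate_eqy E) p1 => ->; rewrite ltxx.
Qed.

Section bounded_in_jn.
Context (R : realType) (n : nat).
Local Notation mu := (lebesgue_measure_n R n).
Implicit Types (Q : cube R n) (f : Rn R n -> R[i]).

Lemma measure_setT_gt0 Q : (0 < mu setT)%E.
Proof.
apply: (@lt_le_trans _ _ (mu (cube_set Q))).
  by have := measure_cube Q => ->; rewrite lte_fin volume_gt0.
by apply: le_measure; rewrite ?inE//; exact: measurable_cube.
Qed.

Lemma cmeasurableS (D E : set (Rn R n)) f : measurable E -> D `<=` E ->
  cmeasurable E f -> cmeasurable D f.
Proof. by move=> mE DE [? ?]; split; exact: measurable_funS DE _. Qed.

Lemma integral_powR_le Q f (M q : R) : cmeasurable (cube_set Q) f ->
  0 <= M -> 0 <= q -> {ae mu, forall x, cube_set Q x -> cabs (f x) <= M} ->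
  (\int[mu]_(x in cube_set Q) (cabs (f x) `^ q)%:E <= (volume Q * M `^ q)%:E)%E.
Proof.
move=> mf M0 q0 fM; have mQ := measurable_cube Q.
rewrite mulrC EFinM -measure_cube -integral_cst//.
apply: ae_ge0_le_integral => //.
- by move=> x _; rewrite lee_fin powR_ge0.
- apply/measurable_EFinP; apply: (measurableT_comp (measurable_powR q)).
  exact: cmeasurable_cabs.
- by move=> x _; rewrite lee_fin powR_ge0.
- by apply: filterS fM => x + Qx => /(_ Qx) ?; rewrite lee_fin ge0_ler_powR// nnegrE ?cabs_ge0.
Qed.

Lemma cabs_average_le Q f (M : R) : cmeasurable (cube_set Q) f -> 0 <= M ->
  {ae mu, forall x, cube_set Q x -> cabs (f x) <= M} ->
  cabs (average Q f) <= 2 * M.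
Proof.
move=> mf M0 fM; have mQ := measurable_cube Q; have Q0 := volume_gt0 Q.
have fle : (Lp_norm (cube_set Q) 1 f <= (volume Q * M)%:E)%E.
  rewrite Lp_norm1E//; have := integral_powR_le mf M0 ler01 fM.
  rewrite powRr1//; under eq_integral do rewrite powRr1 ?cabs_ge0//.
  exact.
have Lf : Lp (cube_set Q) 1 f by split=> //; rewrite (le_lt_trans fle)// ltry.
rewrite /average cabsM cabs_real ger0_norm ?invr_ge0 ?(ltW Q0)//.
rewrite mulrC ler_pdivrMr// -lee_fin (le_trans (cabs_cintegral_le mQ Lf))//.
by rewrite -mulrA EFinM lee_pmul2l// mulrC.
Qed.

(** The constant is 1 for [f] plus 2 for its average, whose bound inherits the factor of
    [cabs_cintegral_le]. On large cubes the subtracted constant is 0. *)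
Lemma cabs_sub_P0_le (c0 : R) Q f (M : R) : cmeasurable (cube_set Q) f -> 0 <= M ->
  {ae mu, forall x, cube_set Q x -> cabs (f x) <= M} ->
  {ae mu, forall x, cube_set Q x -> cabs (f x - P0 c0 Q f) <= 3 * M}.
Proof.
move=> mf M0 fM; have PM : cabs (P0 c0 Q f) <= 2 * M.
  rewrite /P0; case: ifP => _; first exact: cabs_average_le.
  by rewrite ComplexField.Normc.normc0 mulr_ge0.
apply: filterS fM => x + Qx => /(_ Qx) fxM.
by rewrite (le_trans (cabsB _ _))//; move: fxM PM; lra.
Qed.

Lemma mean_osc_le (c0 q : R) Q f (M : R) : 0 < q ->
  cmeasurable (cube_set Q) f -> 0 <= M ->
  {ae mu, forall x, cube_set Q x -> cabs (f x) <= M} ->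
  (mean_osc c0 q Q f <= (3 * M)%:E)%E.
Proof.
move=> q0 mf M0 fM; have mQ := measurable_cube Q; have Q0 := volume_gt0 Q.
have M30 : 0 <= 3 * M by rewrite mulr_ge0.
have := @integral_powR_le Q (fun x => f x - P0 c0 Q f) _ q _ M30 (ltW q0)
  (cabs_sub_P0_le c0 mf M0 fM).
move=> /(_ (cmeasurableB mf (cmeasurable_cst _ _))) oscle.
rewrite /mean_osc.
rewrite (@le_trans _ _ (((3 * M) `^ q)%:E `^ q^-1)%E)//; last first.
  by rewrite poweR_EFin -powRrM mulfV ?gt_eqF// powRr1.
apply: ge0_le_poweR; first by rewrite invr_ge0 ltW.
  rewrite mule_ge0 ?lee_fin ?invr_ge0 ?(ltW Q0)// integral_ge0// => x _.
  by rewrite lee_fin powR_ge0.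
rewrite (@le_trans _ _ ((volume Q)^-1%:E * (volume Q * (3 * M) `^ q)%:E)%E)//.
  by rewrite lee_pmul2l// lte_fin invr_gt0.
by rewrite -EFinM mulKf// gt_eqF.
Qed.

(** The mean oscillation is at most 3M on every cube in [Q0], and the volumes of a disjoint family
    add up to at most |Q0|, so each sum in [jn_norm] is at most (3M)^p |Q0| before the root is
    taken. *)
Lemma Linf_jn (c0 : R) (Q0 : cube R n) (p q : R) f : 0 < p -> 0 < q ->
  Lp (cube_set Q0) +oo f -> jn c0 Q0 p q f.
Proof.
move=> p0 q0 Lf; have [mf _] := Lf; have mQ0 := measurable_cube Q0.
have [M M0 fM] := Linf_ae_bounded (measure_setT_gt0 Q0) Lf.
split.
  split=> //; rewrite /Lp_norm unlock; apply: poweR_lty.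
  apply: le_lt_trans (ltry (volume Q0 * M `^ q)).
  apply: le_trans (integral_powR_le mf M0 (ltW q0) fM).
  rewrite [leRHS]integral_mkcond le_eqVlt; apply/orP; left; apply/eqP.
  apply: eq_integral => x _; rewrite /= !patchE; case: ifPn => _.
    by rewrite ger0_norm ?cabs_ge0.
  by rewrite /= normr0 powR0// gt_eqF.
apply: (@le_lt_trans _ _ ((((3 * M) `^ p)%:E * (volume Q0)%:E) `^ p^-1)%E); last first.
  by rewrite -EFinM poweR_EFin ltry.
apply: ge_ereal_sup => _ [J [Q [dQ ->]]]; have [QQ0 _] := dQ.
apply: ge0_le_poweR; first by rewrite invr_ge0 ltW.
  by apply: esum_ge0 => j _; rewrite mule_ge0 ?poweR_ge0// lee_fin ltW ?volume_gt0.
apply: (@le_trans _ _ (\esum_(j in J) (((3 * M) `^ p)%:E * (volume (Q j))%:E))%E).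
  apply: le_esum => j Jj; rewrite muleC lee_pmul2r ?lte_fin ?volume_gt0//.
  rewrite -poweR_EFin; apply: ge0_le_poweR (ltW p0) (poweR_ge0 _ _) _.
  apply: mean_osc_le => //.
    exact: cmeasurableS (QQ0 _ Jj) mf.
  by apply: filterS fM => x + Qx; apply; exact: QQ0 Qx.
have v0 j : (0 <= (volume (Q j))%:E)%E by rewrite lee_fin ltW ?volume_gt0.
rewrite -{1}(set_mem_set J) -nneseries_esum; last first.
  by move=> j _; rewrite mule_ge0// lee_fin powR_ge0.
rewrite nneseriesZl// nneseries_esum// set_mem_set.
by rewrite lee_wpmul2l ?lee_fin ?powR_ge0// esum_volume.
Qed.

End bounded_in_jn.

(** * Local atoms: L^1 bounds and change of exponent *)

Section atoms.
Context (R : realType) (n : nat) (c0 : R).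
Local Notation mu := (lebesgue_measure_n R n).
Implicit Types (Q : cube R n) (a f : Rn R n -> R[i]).

Lemma Lp_normZ (D : set (Rn R n)) (w : \bar R) (r : R) a : (0 < w)%E ->
  (0 < mu setT)%E -> measurable D -> cmeasurable D a -> 0 <= r ->
  (Lp_norm D w (fun x => (real_complex R r * a x)%R) = r%:E * Lp_norm D w a)%E.
Proof.
move=> w0 muT mD ma r0; rewrite /Lp_norm.
have mA : measurable_fun setT ((fun x => cabs (a x)) \_ D).
  by apply/(measurable_restrict _ mD) => //; rewrite setTI; exact: cmeasurable_cabs.
have -> : EFin \o (fun x => cabs (real_complex R r * a x)) \_ D =
    (fun x => r%:E * (EFin \o (fun x => cabs (a x)) \_ D) x)%E.
  apply/funext => x /=; rewrite !patchE; case: ifPn => _; last by rewrite mule0.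
  by rewrite cabsM cabs_real ger0_norm// EFinM.
rewrite unlock; case: w w0 => [w w0| _|//] /=; last first.
  rewrite muT -ess_supZl//; congr ess_sup; apply/funext => x /=.
  by rewrite normrM ger0_norm// EFinM.
rewrite lte_fin in w0.
under eq_integral do rewrite normrM (ger0_norm r0) powRM// EFinM.
rewrite ge0_integralZl_EFin ?powR_ge0//; last first.
  apply/measurable_EFinP; apply: (measurableT_comp (measurable_powR w)).
  exact: measurableT_comp.
rewrite poweRM ?lee_fin ?powR_ge0//; last first.
  by apply: integral_ge0 => x _; rewrite lee_fin powR_ge0.
by rewrite poweR_EFin -powRrM mulfV ?gt_eqF// powRr1.
Qed.

Lemma cintegral_sub (D E : set (Rn R n)) a : measurable D -> measurable E ->
  E `<=` D -> [set x | a x != 0] `<=` E -> cintegral D a = cintegral E a.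
Proof.
move=> mD mE ED aE; rewrite -[in RHS](setIidr ED); apply: complex_eqP => /=.
- rewrite Rintegral_mkcondr; apply: eq_Rintegral => x _.
  rewrite patchE; case: ifPn => // /negP xE.
  by have [->//|ax] := eqVneq (a x) 0; case: xE; rewrite inE; exact: aE.
- rewrite Rintegral_mkcondr; apply: eq_Rintegral => x _.
  rewrite patchE; case: ifPn => // /negP xE.
  by have [->//|ax] := eqVneq (a x) 0; case: xE; rewrite inE; exact: aE.
Qed.

Lemma Lp_norm_sub (D E : set (Rn R n)) w a :
  E `<=` D -> [set x | a x != 0] `<=` E -> Lp_norm D w a = Lp_norm E w a.
Proof.
move=> ED aE; rewrite /Lp_norm; congr Lnorm; congr (_ \o _).
apply/funext => x; rewrite !patchE.
have [xE|xE] := boolP (x \in E); first by rewrite mem_set//; exact/ED/set_mem.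
have [ax0|ax] := eqVneq (a x) 0.
  by rewrite ax0 ComplexField.Normc.normc0; case: ifP.
by case/negP : xE; rewrite inE; exact: aE.
Qed.

(** For finite [w] this is Hoelder's inequality against the indicator of the cube, whose norm in the
    conjugate exponent is |Q|^(1 - 1/w). For [w = +oo] the essential bound is integrated over the
    cube. *)
Lemma Lp_norm1_le w Q a : (1 < w)%E -> cmeasurable (cube_set Q) a ->
  (Lp_norm (cube_set Q) 1 a <=
   Lp_norm (cube_set Q) w a * (volume Q `^ (1 - fine (w^-1)%E))%:E)%E.
Proof.
move=> w1 maQ; have mQ := measurable_cube Q; have Q0 := volume_gt0 Q.
pose A := (fun x => cabs (a x)) \_ (cube_set Q).
have mA : measurable_fun setT A.
  by apply/(measurable_restrict _ mQ) => //; rewrite setTI; exact: cmeasurable_cabs.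
case: w w1 => [w||//]; last first.
  move=> _; rewrite invey /= subr0 powRr1 ?(ltW Q0)//.
  (* An infinite norm makes the right-hand side infinite, since the volume is positive. *)
  have [ay|ay] := eqVneq (Lp_norm (cube_set Q) +oo a) +oo%E.
    by rewrite ay gt0_mulye ?lte_fin// leey.
  have La : Lp (cube_set Q) +oo a by split=> //; rewrite ltey.
  have afin : Lp_norm (cube_set Q) +oo a \is a fin_num.
    by rewrite ge0_fin_numE ?Lnorm_ge0// ltey.
  have := integral_powR_le maQ _ ler01 (Linf_ae_le (measure_setT_gt0 Q) La).
  rewrite fine_ge0 ?Lnorm_ge0// => /(_ isT).
  rewrite powRr1 ?fine_ge0 ?Lnorm_ge0//.
  under eq_integral do rewrite powRr1 ?cabs_ge0//.
  by rewrite -Lp_norm1E EFinM (fineK afin) [leRHS]muleC.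
rewrite lte_fin => w1; have w0 : 0 < w by rewrite (lt_trans ltr01).
have w1' : 0 < 1 - w^-1 by rewrite subr_gt0 invf_lt1.
rewrite inver gt_eqF//=.
have m1 : measurable_fun setT (\1_(cube_set Q) : Rn R n -> R).
  exact: measurable_indic.
have := @hoelder _ _ R mu A (\1_(cube_set Q)) w (1 - w^-1)^-1 mA m1 w0.
rewrite invr_gt0 invrK subrKC => /(_ w1' erefl).
have -> : EFin \o (A \* \1_(cube_set Q))%R = EFin \o A.
  apply/funext => x /=; rewrite /A patchE indicE.
  by case: ifPn => _; rewrite ?mulr1 ?mul0r.
have -> // : ('N[mu]_((1 - w^-1)^-1%R)%:E[EFin \o \1_(cube_set Q)] =
    ((volume Q) `^ (1 - w^-1))%:E)%E.
rewrite unlock invrK -poweR_EFin -measure_cube; congr (_ `^ _)%E.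
rewrite -[in RHS](setIT (cube_set Q)) -integral_indic//.
apply: eq_integral => x _; rewrite /= indicE.
by case: (x \in _); rewrite ?normr1 ?powR1 ?normr0 ?powR0// gt_eqF ?invr_gt0.
Qed.

(** The exponent [w] cancels: (1/w - 1/v) + (1 - 1/w) = 1 - 1/v. For [v = 1] the bound is 1, which
    is how the lemma is mostly used. *)
Lemma atom_Lp_norm1 v w Q a : (1 < w)%E -> local_atom c0 v w Q a ->
  (Lp_norm (cube_set Q) 1 a <= (volume Q `^ (1 - v^-1))%:E)%E.
Proof.
move=> w1 [ma _ aw _]; have Q0 := volume_gt0 Q.
have maQ : cmeasurable (cube_set Q) a.
  by apply: cmeasurableS ma => //; exact: subsetT.
apply: le_trans (Lp_norm1_le w1 maQ) _.
apply: (@le_trans _ _ ((volume Q `^ (fine (w^-1)%E - v^-1))%:E *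
    (volume Q `^ (1 - fine (w^-1)%E))%:E)%E).
  by rewrite lee_pmul2r// lte_fin powR_gt0.
by rewrite -EFinM -gt0_powRD// lee_fin addrC subrKA.
Qed.

Lemma atom_Lp1 v w Q a : (1 < w)%E -> local_atom c0 v w Q a -> Lp (cube_set Q) 1 a.
Proof.
move=> w1 aQ; split; last by rewrite (le_lt_trans (atom_Lp_norm1 w1 aQ))// ltry.
by case: aQ => ma _ _ _; apply: cmeasurableS ma => //; exact: subsetT.
Qed.

Lemma atom_rescale (v : R) w Q a : (1 < w)%E -> local_atom c0 v w Q a ->
  local_atom c0 1 w Q (fun x => real_complex R (volume Q `^ (v^-1 - 1)) * a x).
Proof.
move=> w1 aat; have [ma aQ aw a0] := aat.
have mQ := measurable_cube Q; have Q0 := volume_gt0 Q.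
have La := atom_Lp1 w1 aat; split.
- by apply: cmeasurableM => //; exact: cmeasurable_cst.
- by move=> x /=; rewrite mulf_eq0 negb_or => /andP[_]; exact: aQ.
- rewrite Lp_normZ ?powR_ge0//.
  + apply: (@le_trans _ _ ((volume Q `^ (v^-1 - 1))%:E *
        (volume Q `^ (fine (w^-1)%E - v^-1))%:E)%E).
      by rewrite lee_pmul2l// lte_fin powR_gt0.
    (* The exponents add up to 1/w - 1, the size condition of a (1, w)-atom. *)
    rewrite -EFinM -gt0_powRD// lee_fin invr1.
    by rewrite [_ + (_ - v^-1)]addrC subrKA.
  + exact: lt_trans w1.
  + exact: measure_setT_gt0 Q.
  + by case: La.
- by move=> Qc0; rewrite cintegralZ// a0// mulr0.
Qed.

Lemma local_atom0 (v : R) w Q : (1 < w)%E -> local_atom c0 v w Q (fun=> 0).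
Proof.
move=> w1; split.
- exact: cmeasurable_cst.
- by move=> x /=; rewrite eqxx.
- rewrite /Lp_norm (_ : _ \o _ = cst 0%E); last first.
    by apply/funext => x /=; rewrite patchE /= expr0n/= addr0 sqrtr0; case: ifP.
  rewrite Lnorm0 ?lee_fin ?powR_ge0//.
  by rewrite gt_eqF// (lt_trans _ w1).
- by move=> _; exact: (cintegral0 (measurable_cube Q)).
Qed.

End atoms.

(** * From hk to the atomic Hardy space *)

Section hardy_embedding.
Context (R : realType) (n : nat) (c0 : R) (Q0 : cube R n).
Local Notation mu := (lebesgue_measure_n R n).
Local Notation func := (Rn R n -> R[i]).
Implicit Types (Q : nat -> cube R n) (a : nat -> func) (lam : nat -> R[i]).

(** Atoms with [v = 1] have L^1 norm at most 1, so summable coefficients make the series absolutely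
    convergent in L^1. The last clause is what later identifies the sum [h] with the functional
    [g]. *)
Lemma h1at_series w Q a lam : (1 < w)%E ->
  (forall j, cube_set (Q j) `<=` cube_set Q0) ->
  (forall j, local_atom c0 1 w (Q j) (a j)) ->
  (\sum_(0 <= j <oo) (cabs (lam j))%:E < +oo)%E ->
  exists h, [/\ Lp (cube_set Q0) 1 h,
    h1at_decomposition c0 Q0 w h Q a lam &
    forall f, Lp (cube_set Q0) +oo f ->
      ccvg (fun N => \sum_(k < N) lam k * atom_action (Q k) (a k) f)
           (cintegral (cube_set Q0) (fun x => h x * f x))].
Proof.
move=> w1 QQ0 aQ lamfin; have mQ0 := measurable_cube Q0.
have muT := measure_setT_gt0 Q0.
have anorm j : (Lp_norm (cube_set Q0) 1 (a j) <= 1)%E.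
  have [_ aQj _ _] := aQ j.
  rewrite (Lp_norm_sub _ (QQ0 j) aQj); have := atom_Lp_norm1 w1 (aQ j).
  by rewrite invr1 subrr powRr0.
have aL j : Lp (cube_set Q0) 1 (a j).
  split; last by rewrite (le_lt_trans (anorm j))// ltry.
  by case: (aQ j) => ma _ _ _; apply: cmeasurableS ma => //; exact: subsetT.
have lamM (f : func) k : Lp (cube_set Q0) 1 f ->
    Lp (cube_set Q0) 1 (fun x => f x * lam k).
  move=> Lf; apply: (@Lp1M _ _ _ mQ0 _ _ (cabs (lam k))) => //.
  - exact: cabs_ge0.
  - exact: nearW.
have uL k : Lp (cube_set Q0) 1 (fun x => lam k * a k x).
  by under eq_fun do rewrite mulrC; exact: lamM.
have [k||h Lh hE] := @L1_cseries R n _ mQ0 (fun k x => lam k * a k x).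
- by case: (uL k).
- apply: le_lt_trans lamfin; apply: lee_nneseries => k _.
    by move=> _; exact: Lnorm_ge0.
  apply: (@le_trans _ _ ((cabs (lam k))%:E * Lp_norm (cube_set Q0) 1 (a k))%E).
    under eq_fun do rewrite mulrC.
    apply: Lp_norm1M_le => //; [by case: (aL k)|exact: cabs_ge0|].
    exact: nearW.
  by rewrite -[leRHS]mule1 lee_wpmul2l// lee_fin cabs_ge0.
exists h; split=> // f Lf.
have := cintegralM_cvg mQ0 muT (fun N => @Lp1_sum _ _ _ mQ0 N _ uL) Lh Lf hE.
rewrite (_ : (fun N => cintegral _ _) =
  (fun N => \sum_(k < N) lam k * atom_action (Q k) (a k) f))//.
apply/funext => N; have [M M0 fM] := Linf_ae_bounded muT Lf.
have afL k : Lp (cube_set Q0) 1 (fun x => a k x * f x).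
  by apply: (Lp1M mQ0 (aL k) _ M0 fM); case: Lf.
under eq_fun do rewrite mulr_suml.
rewrite (@cintegral_sum _ _ _ mQ0 N (fun k x => lam k * a k x * f x)) => [|k]; last first.
  by under eq_fun do rewrite -mulrA mulrC; exact: lamM.
apply: eq_bigr => k _; under eq_fun do rewrite -mulrA.
(* [atom_action] integrates over the cube of the atom, the pairing with [h] over [Q0]; they agree
   because the atom vanishes off its cube. *)
rewrite cintegralZ//; congr (_ * _); apply: cintegral_sub => //.
- exact: measurable_cube.
- move=> x /=; rewrite mulf_eq0 negb_or => /andP[ax _].
  by case: (aQ k) => _ aQk _ _; exact: aQk.
Qed.

Lemma represents_ae_unique (g : functional R n) h1 h2 :
  represents Q0 g h1 -> represents Q0 g h2 ->
  Lp_norm (cube_set Q0) 1 (fun x => h1 x - h2 x) = 0%E.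
Proof.
move=> [L1 g1] [L2 g2]; apply: Lp_norm1_eq0 => //; first exact: measurable_cube.
by move=> f Lf; rewrite -g1// g2.
Qed.

(** By the triangle inequality, a change of [h] on a null set does not increase its L^1 distance to
    the partial sums. This carries a decomposition of one representative of [g] over to any
    other. *)
Lemma h1at_decomposition_ae w h1 h2 Q a lam :
  Lp (cube_set Q0) 1 h1 -> Lp (cube_set Q0) 1 h2 ->
  Lp_norm (cube_set Q0) 1 (fun x => h1 x - h2 x) = 0%E ->
  h1at_decomposition c0 Q0 w h2 Q a lam -> h1at_decomposition c0 Q0 w h1 Q a lam.
Proof.
move=> [m1 _] [m2 _] h12 [QQ0 aQ lamfin cv]; have mQ0 := measurable_cube Q0.
split=> //; apply: squeeze_cvge (cvg_cst 0%E) cv.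
apply: nearW => N; rewrite Lnorm_ge0/=.
rewrite -[leRHS]add0e -h12; apply: Lp_norm1_triangle => //.
apply: (@cmeasurable_sum _ _ _ N (fun j x => lam j * a j x)) => j.
apply: cmeasurableM; first exact: cmeasurable_cst.
by case: (aQ j) => ma _ _ _; apply: cmeasurableS ma => //; exact: subsetT.
Qed.

(** Rescaling moves a power of the volume from atom to coefficient and leaves their product
    unchanged, so the partial sums act as before; the weak-* hypothesis reaches bounded [f] through
    [Linf_jn]. The family is re-indexed by all of [nat], as [h1at_decomposition] requires. *)
Lemma hkt_decomposition_normalize (v : R) w g J Q a lam :
  1 < v -> (1 < w)%E -> hkt_decomposition c0 Q0 v w g J Q a lam ->
  exists Q' a' lam',
    [/\ forall j, cube_set (Q' j) `<=` cube_set Q0,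
        forall j, local_atom c0 1 w (Q' j) (a' j),
        (\sum_(0 <= j <oo) (cabs (lam' j))%:E <=
         (\esum_(j in J) ((cabs (lam j)) `^ v)%:E) `^ v^-1 *
         (volume Q0 `^ (1 - v^-1))%:E)%E &
        forall f, Lp (cube_set Q0) +oo f ->
          ccvg (fun N => \sum_(j < N) lam' j * atom_action (Q' j) (a' j) f)
               (g f)].
Proof.
move=> v1 w1 [dQ aQ lamfin gcv]; have [QQ0 _] := dQ.
have v0 : 0 < v by rewrite (lt_trans ltr01).
(* Indices outside [J] carry junk data: they get the zero atom on [Q0]. *)
pose r j : R := volume (Q j) `^ (v^-1 - 1).
exists (fun j => if j \in J then Q j else Q0),
  (fun j => if j \in J then (fun x => real_complex R (r j) * a j x) else (fun=> 0)),
  (fun j => if j \in J then lam j * real_complex R (volume (Q j) `^ (1 - v^-1)) else 0).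
split.
- by move=> j; case: ifPn => [/set_mem /QQ0//|_]; exact: subset_refl.
- move=> j; case: ifPn => [/set_mem Jj|_]; last exact: local_atom0.
  by apply: atom_rescale => //; exact: aQ.
(* Extension by 0 off [J] lets [hoelder_series] run over all indices without changing either sum on
   its right-hand side. *)
- pose x j : R := if j \in J then cabs (lam j) else 0.
  pose b j : R := if j \in J then volume (Q j) else 0.
  have x0 j : 0 <= x j by rewrite /x; case: ifP => // _; exact: cabs_ge0.
  have b0 j : 0 <= b j by rewrite /b; case: ifP => // _; exact/ltW/volume_gt0.
  rewrite (eq_eseriesr (g := fun j => (x j * b j `^ (1 - v^-1))%:E)); last first.
    move=> j _; rewrite /x /b; case: ifP => _.
      by rewrite cabsM cabs_real ger0_norm ?powR_ge0.
    by rewrite ComplexField.Normc.normc0 mul0r.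
  apply: le_trans (hoelder_series v1 x0 b0) _.
  have -> : (\sum_(0 <= k <oo) (x k `^ v)%:E =
      \esum_(j in J) ((cabs (lam j)) `^ v)%:E)%E.
    rewrite nneseries_esumT; last by move=> j; rewrite lee_fin powR_ge0.
    rewrite [RHS]esum_mkcond; apply: eq_esum => j _; rewrite /x.
    by case: ifP => // _; rewrite powR0// gt_eqF.
  rewrite lee_wpmul2l ?poweR_ge0// -poweR_EFin.
  apply: ge0_le_poweR.
  + by rewrite subr_ge0 invf_le1// ltW.
  + by apply: nneseries_ge0 => j _ _; rewrite lee_fin.
  + rewrite nneseries_esumT; last by move=> j; rewrite lee_fin.
    apply: le_trans (esum_volume dQ); rewrite [leRHS]esum_mkcond.
    by apply: le_esum => j _; rewrite /b; case: ifP.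
- move=> f Lf.
  have jf : jn c0 Q0 (conj_exponent v%:E) (conj_exponent w) f.
    by apply: Linf_jn => //; rewrite (lt_le_trans ltr01)// conj_exponent_ge1// lte_fin.
  have := gcv f jf; congr ccvg; apply/funext => N.
  rewrite big_mkcond/=; apply: eq_bigr => j _.
  case: ifPn => [/set_mem Jj|_]; last by rewrite mul0r.
  rewrite /atom_action.
  under [in RHS]eq_fun do rewrite -mulrA.
  have La := atom_Lp1 w1 (aQ _ Jj).
  have mQj := measurable_cube (Q j).
  have [M M0 fM] := Linf_ae_bounded (measure_setT_gt0 Q0) Lf.
  rewrite (cintegralZ mQj); last first.
    apply: (Lp1M mQj La _ M0).
      by case: Lf => mf _; apply: cmeasurableS mf; [exact: measurable_cube|exact: QQ0].
    by apply: filterS fM => x + Qx; apply; exact: QQ0 Qx.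
  have rV : real_complex R (volume (Q j) `^ (1 - v^-1)) * real_complex R (r j) = 1.
    by rewrite -rmorphM /= /r -gt0_powRD ?volume_gt0// subrKA subrr powRr0.
  by rewrite -[RHS]mulrA [X in _ = _ * X]mulrA rV mul1r.
Qed.

Lemma hkt_norm_ge0 (v : R) w g : (0 <= hkt_norm c0 Q0 v w g)%E.
Proof.
by apply: le_ereal_inf_tmp => _ [J [Q [a [lam [_ ->]]]]]; exact: poweR_ge0.
Qed.

(** Each [gs i] gets a decomposition within e/2^(i+1) of its norm, so the errors add up to [e]; a
    bijection from [nat] to pairs merges them. The last clause, where [h] is a number, presupposes
    convergence of the merged series: [h1at_series] provides it later. *)
Lemma hk_decomposition_flatten (v : R) w g gs (e : R) : 1 < v -> (1 < w)%E ->
  hk_decomposition c0 Q0 v w g gs -> 0 < e ->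
  exists Q a lam,
    [/\ forall j, cube_set (Q j) `<=` cube_set Q0,
        forall j, local_atom c0 1 w (Q j) (a j),
        (\sum_(0 <= j <oo) (cabs (lam j))%:E <= (volume Q0 `^ (1 - v^-1))%:E *
         (\sum_(0 <= i <oo) hkt_norm c0 Q0 v w (gs i) + e%:E))%E &
        forall f h, Lp (cube_set Q0) +oo f ->
          ccvg (fun N => \sum_(j < N) lam j * atom_action (Q j) (a j) f) h ->
          g f = h].
Proof.
move=> v1 w1 [gsk gsfin gcv] e0.
pose K := volume Q0 `^ (1 - v^-1); have K0 : 0 < K by exact/powR_gt0/volume_gt0.
pose N_ i := hkt_norm c0 Q0 v w (gs i).
have N0 i : (0 <= N_ i)%E by exact: hkt_norm_ge0.
have Nfin i : N_ i \is a fin_num.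
  rewrite ge0_fin_numE// (le_lt_trans _ gsfin)//.
  exact: nneseries_term_le.
have /choice[D HD] : forall i, exists D : (nat -> cube R n) * (nat -> func) * (nat -> R[i]),
    [/\ forall j, cube_set (D.1.1 j) `<=` cube_set Q0,
        forall j, local_atom c0 1 w (D.1.1 j) (D.1.2 j),
        (\sum_(0 <= j <oo) (cabs (D.2 j))%:E <=
          K%:E * (N_ i + (e / (2 ^ i.+1)%:R)%:E))%E &
        forall f, Lp (cube_set Q0) +oo f ->
          ccvg (fun N => \sum_(j < N) D.2 j * atom_action (D.1.1 j) (D.1.2 j) f)
               (gs i f)].
  move=> i; have ei : 0 < e / (2 ^ i.+1)%:R by rewrite divr_gt0// ltr0n expn_gt0.
  (* A near-minimizer exists because the infimum is finite, being one term of a convergent sum of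
     norms. *)
  have [_ [J [Q [a [lam [dec ->]]]]] /ltW xle] := lb_ereal_inf_adherent ei (Nfin i).
  have [Q' [a' [lam' [QQ0 aQ lamle gcv']]]] := hkt_decomposition_normalize v1 w1 dec.
  exists (Q', a', lam'); split=> //=.
  by rewrite (le_trans lamle)// muleC lee_wpmul2l// lee_fin ltW.
have /card_set_bijP[p bp] : ([set: nat] #= [set: nat * nat])%card.
  by rewrite card_eq_sym card_nat2.
exists (fun k => (D (p k).1).1.1 (p k).2), (fun k => (D (p k).1).1.2 (p k).2),
  (fun k => (D (p k).1).2 (p k).2).
have lamle : (\sum_(0 <= j <oo) (cabs ((D (p j).1).2 (p j).2))%:E <=
    K%:E * (\sum_(0 <= i <oo) N_ i + e%:E))%E.
  rewrite [leLHS]nneseries_esumT; last by move=> j; rewrite lee_fin cabs_ge0.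
  rewrite -(reindex_esum setT setT p (fun k => (cabs ((D k.1).2 k.2))%:E) bp).
  rewrite (_ : [set: nat * nat] = [set: nat] `*`` (fun=> [set: nat])); last first.
    by apply/seteqP; split.
  rewrite -(esum_esum (a := fun i j => (cabs ((D i).2 j))%:E)); last first.
    by move=> *; rewrite lee_fin cabs_ge0.
  apply: (@le_trans _ _ (\esum_(i in [set: nat])
      (K%:E * (N_ i + (e / (2 ^ i.+1)%:R)%:E)))%E).
    apply: le_esum => i _; rewrite -nneseries_esumT; first by case: (HD i).
    by move=> j; rewrite lee_fin cabs_ge0.
  have Ne0 i : (0 <= N_ i + (e / (2 ^ i.+1)%:R)%:E)%E.
    by rewrite adde_ge0// lee_fin divr_ge0// ltW.
  rewrite -nneseries_esumT; last by move=> i; rewrite mule_ge0// lee_fin ltW.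
  rewrite nneseriesZl// lee_wpmul2l ?lee_fin ?(ltW K0)//.
  by apply: epsilon_trick => //; exact: ltW.
split=> //.
- by move=> j; case: (HD (p j).1).
- by move=> j; case: (HD (p j).1).
move=> f h Lf lamcv.
have jf : jn c0 Q0 (conj_exponent v%:E) (conj_exponent w) f.
  by apply: Linf_jn => //; rewrite (lt_le_trans ltr01)// conj_exponent_ge1// lte_fin.
have [M M0 fM] := Linf_ae_bounded (measure_setT_gt0 Q0) Lf.
pose z (k : nat * nat) := (D k.1).2 k.2 * atom_action ((D k.1).1.1 k.2) ((D k.1).1.2 k.2) f.
apply: (@double_cseries R z p (fun i => gs i f) _ _ bp _ _ (gcv f jf) lamcv);
  last first.
  by move=> i; case: (HD i) => _ _ _ /(_ f Lf).
(* Absolute summability, the hypothesis of [double_cseries]: an atom of L^1 norm at most 1 acts on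
   [f] with modulus at most [2 * M]. *)
have zle k : ((cabs (z k))%:E <= (2 * M)%:E * (cabs ((D k.1).2 k.2))%:E)%E.
  rewrite /z cabsM EFinM muleC lee_wpmul2r ?lee_fin ?cabs_ge0//.
  have [QQ0 aQ _ _] := HD k.1.
  set Q := (D k.1).1.1 k.2; set a := (D k.1).1.2 k.2.
  have mQ := measurable_cube Q.
  have La : Lp (cube_set Q) 1 a by exact: atom_Lp1 w1 (aQ _).
  have mf : cmeasurable (cube_set Q) f.
    by case: Lf => mf _; apply: cmeasurableS mf; [exact: measurable_cube|exact: QQ0].
  have fMQ : {ae mu, forall x, cube_set Q x -> cabs (f x) <= M}.
    by apply: filterS fM => x + Qx; apply; exact: QQ0 Qx.
  rewrite -lee_fin (le_trans (cabs_cintegral_le mQ (Lp1M mQ La mf M0 fMQ)))//.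
  rewrite EFinM lee_wpmul2l//.
  apply: le_trans (Lp_norm1M_le mQ _ mf M0 fMQ) _; first by case: La.
  rewrite -[leRHS]mule1 lee_wpmul2l ?lee_fin//.
  by have := atom_Lp_norm1 w1 (aQ k.2); rewrite invr1 subrr powRr0.
apply: (@le_lt_trans _ _ (\sum_(0 <= k <oo)
    ((2 * M)%:E * (cabs ((D (p k).1).2 (p k).2))%:E))%E).
  by apply: lee_nneseries => k _ //; rewrite lee_fin cabs_ge0.
rewrite nneseriesZl; last by move=> k _; rewrite lee_fin cabs_ge0.
rewrite lte_mul_pinfty ?lee_fin ?mulr_ge0//.
apply: le_lt_trans lamle _; rewrite lte_mul_pinfty ?lee_fin ?(ltW K0)//.
by rewrite lte_add_pinfty// ltry.
Qed.

(** For bounded [f], the merged series converges to the pairing of its L^1 sum with [f], and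
    flattening says that this limit is [g f]. The resulting [h] may change with [gs] and [e], but
    only on a null set. *)
Lemma hk_decomposition_h1at (v : R) w g gs (e : R) : 1 < v -> (1 < w)%E ->
  hk_decomposition c0 Q0 v w g gs -> 0 < e ->
  exists h Q a lam, [/\ represents Q0 g h, h1at_decomposition c0 Q0 w h Q a lam &
    (\sum_(0 <= j <oo) (cabs (lam j))%:E <= (volume Q0 `^ (1 - v^-1))%:E *
      (\sum_(0 <= i <oo) hkt_norm c0 Q0 v w (gs i) + e%:E))%E].
Proof.
move=> v1 w1 dec e0; have [_ gsfin _] := dec.
have [Q [a [lam [QQ0 aQ lamle gE]]]] := hk_decomposition_flatten v1 w1 dec e0.
have lamfin : (\sum_(0 <= j <oo) (cabs (lam j))%:E < +oo)%E.
  apply: le_lt_trans lamle _; rewrite lte_mul_pinfty ?lee_fin ?powR_ge0//.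
  by rewrite lte_add_pinfty// ltry.
have [h [Lh hdec hcv]] := h1at_series w1 QQ0 aQ lamfin.
exists h, Q, a, lam; split=> //; split=> // f Lf.
by apply: gE => //; exact: hcv.
Qed.

(** If [g] has no decomposition for [v], the infimum defining [hk_norm] is over the empty set and
    equals +oo. The bound thus holds for every [v > 1], as the lower limit requires. *)
Lemma h1at_norm_le_hk_norm (v : R) w g h : 1 < v -> (1 < w)%E ->
  represents Q0 g h ->
  (h1at_norm c0 Q0 w h <= (volume Q0 `^ (1 - v^-1))%:E * hk_norm c0 Q0 v w g)%E.
Proof.
move=> v1 w1 gh; set K := volume Q0 `^ (1 - v^-1).
have K0 : 0 < K by exact/powR_gt0/volume_gt0.
rewrite -lee_pdivrMl//; apply: le_ereal_inf_tmp => _ [gs [dec ->]].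
rewrite lee_pdivrMl//; apply/lee_addgt0Pr => e e0.
(* The slack is divided by [K] because the estimate multiplies it by [K]. *)
have eK0 : 0 < e / K by rewrite divr_gt0.
have [h' [Q [a [lam [gh' hdec lamle]]]]] := hk_decomposition_h1at v1 w1 dec eK0.
(* [h'] depends on [gs] and [e]; the decomposition is moved to the fixed [h] before the infimum is
   taken. *)
have {}hdec : h1at_decomposition c0 Q0 w h Q a lam.
  apply: h1at_decomposition_ae hdec; [by case: gh|by case: gh'|].
  exact: represents_ae_unique gh gh'.
apply: (@le_trans _ _ (\sum_(0 <= j <oo) (cabs (lam j))%:E)%E).
  by apply: ereal_inf_lbound; exists Q, a, lam.
apply: le_trans lamle _; rewrite muleDr//; last first.
  by rewrite ge0_adde_def// inE ?lee_fin ?(ltW eK0)// nneseries_ge0// => *; exact: hkt_norm_ge0.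
by rewrite leeD2l// -EFinM lee_fin mulrC divfK// gt_eqF.
Qed.

End hardy_embedding.

Theorem proposition5p7 (R : realType) (n : nat) (n_gt0 : (0 < n)%N)
    (w : \bar R) (w_gt1 : (1 < w)%E)
    (Q0 : cube R n) (Q0_proper : cube_set Q0 `<` setT)
    (c0 : R) (c0_gt0 : 0 < c0) (c0_lt_side : c0 < side Q0) :
  (forall g : functional R n,
     (exists2 v : R, 1 < v & hk c0 Q0 v w g) ->
     (exists h, represents Q0 g h) /\
     (forall h, represents Q0 g h -> h1at c0 Q0 w h)) /\
  (forall (g : functional R n) (h : Rn R n -> R[i]),
     (exists2 v : R, 1 < v & hk c0 Q0 v w g) ->
     represents Q0 g h ->
     (h1at_norm c0 Q0 w h <=
        limf_einf (fun v : R => hk_norm c0 Q0 v w g) 1^'+)%E).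
Proof.
have hkE (g : functional R n) (v : R) : 1 < v -> hk c0 Q0 v w g ->
    exists h Q a lam, represents Q0 g h /\ h1at_decomposition c0 Q0 w h Q a lam.
  move=> v1 [_ [gs dec]].
  (* Only existence is wanted here, so the slack is simply 1. *)
  have [h [Q [a [lam [gh hdec _]]]]] :=
    hk_decomposition_h1at v1 w_gt1 dec ltr01.
  by exists h, Q, a, lam.
split=> [g [v v1 /(hkE _ _ v1)[h0 [Q [a [lam [gh0 hdec]]]]]]|g h [v v1 _] gh].
  split=> [|h gh]; first by exists h0.
  split; first by case: gh.
  exists Q, a, lam; apply: h1at_decomposition_ae hdec.
  - by case: gh.
  - by case: gh0.
  - exact: represents_ae_unique gh gh0.
(* It suffices to bound [r] times the norm for each [r] in (0, 1). The gap between [r] and 1 absorbs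
   the factor |Q0|^(1 - 1/u) once [u] is close to 1, whether |Q0| is large or small. *)
rewrite limf_einfE; apply/lee_mul01Pr => [|r /andP[r0 r1]].
  by apply: le_ereal_inf_tmp => _ [Q [a [lam [_ ->]]]]; apply: nneseries_ge0 => j _ _;
    rewrite lee_fin cabs_ge0.
(* In logarithms, r |Q0|^(1 - 1/u) <= 1 reads (1 - 1/u) ln |Q0| <= - ln r, where the left side tends
   to 0 and the right side is positive. *)
have kcvg : (fun u : R => (1 - u^-1) * ln (volume Q0)) @ 1^'+ -->
    (1 - 1^-1) * ln (volume Q0).
  apply: cvgM; last exact: cvg_cst.
  apply: cvgB; first exact: cvg_cst.
  apply: cvgV; first exact: oner_neq0.
  by apply: cvg_at_right_filter; exact: cvg_id.
have ln_r0 : (1 - 1^-1) * ln (volume Q0) < - ln r.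
  by rewrite invr1 subrr mul0r oppr_gt0 ln_lt0// r0.
pose V := [set u : R | 1 < u /\ r * volume Q0 `^ (1 - u^-1) <= 1].
have nV : 1^'+ V.
  near=> u; split; first by near: u; exact: nbhs_right_gt.
  have kr : (1 - u^-1) * ln (volume Q0) < - ln r.
    by near: u; exact: cvgr_lt kcvg _ ln_r0.
  rewrite /powR gt_eqF ?volume_gt0// -{1}(lnK (x := r)) ?posrE// -expRD.
  by rewrite -[leRHS]expR0 ler_expR; move: kr; lra.
apply: (@le_trans _ _ (ereal_inf ((fun u => hk_norm c0 Q0 u w g) @` V))).
  apply: le_ereal_inf_tmp => _ [u [u1 uK] <-].
  apply: (@le_trans _ _ (r%:E * ((volume Q0 `^ (1 - u^-1))%:E *
      hk_norm c0 Q0 u w g))%E).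
    by rewrite lee_pmul2l// h1at_norm_le_hk_norm.
  rewrite muleA -EFinM -[leRHS]mul1e lee_wpmul2r//.
  apply: le_ereal_inf_tmp => _ [gs [_ ->]]; apply: nneseries_ge0 => j _ _.
  exact: hkt_norm_ge0.
(* The lower limit is the supremum, over right neighbourhoods of 1, of the infimum of the norms; [V]
   is one such neighbourhood. *)
by apply: ereal_sup_ubound; exists V.
Unshelve. all: by end_near. Qed.
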